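(* Let $\mathbf{k}$ be a field of characteristic zero and let $(W,d)$ be a $\mathbf{Z}_2$-graded differential $\mathbf{k}$-algebra with trivial cohomology, $H(W,d)\cong\mathbf{k}$. Let $p_1,\dots,p_r$ be linearly independent elements of the even part $Z^{even}(W)$ of the super-center of $W$ such that each $p_i$ is a coboundary and such that the subalgebra of $W$ generated by $1,p_1,\dots,p_r$ is the polynomial algebra $SP=\mathbf{k}[p_1,\dots,p_r]$ (the symmetric algebra of $P=\langle p_1,\dots,p_r\rangle_{\mathbf{k}}$). Let $\langle S^+P\rangle\subset W$ be the ideal generated by the augmentation ideal $S^+P$ of $SP$. If $W$ is a free $SP$-module, then there is an isomorphism of algebras $$H(W/\langle S^+P\rangle,d)\;\cong\;\mathrm{Cl}(P,B).$$ Moreover, this isomorphism is given by $P\ni p\mapsto [C_p]_d\in H(W/\langle S^+P\rangle,d)$, where $C_p\in W$ is a cochain of transgression for $p$, and the symmetric bilinear form $B$ is given by $$B:P\times P\to\mathbf{k},\qquad B(p,q)=\tfrac12\,\big[C_p\cdot C_q+C_q\cdot C_p\big]_d\in H(W,d)\cong\mathbf{k}.$$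
   Context: Algebras are associative and unital, not necessarily commutative. A $\mathbf{Z}_2$-graded differential algebra $(W,d)$ is a $\mathbf{Z}_2$-graded algebra with an odd (super-)derivation $d$ satisfying $d^2=0$; its cohomology is $\ker d/\operatorname{im} d$, and $H(W,d)\cong\mathbf{k}$ means that the cohomology is spanned by the class of $1\neq 0$. The super-center $Z(W)$ is the set of elements that super-commute with all of $W$. $W$ is an $SP$-module by multiplication. $S^+P$ is the kernel of the augmentation $SP\to\mathbf{k}$ sending every $p_i$ to $0$; since $d$ vanishes on $SP$, $d$ descends to $W/\langle S^+P\rangle$. A cochain of transgression for $p\in P$ is an odd element $C_p\in W$ with $dC_p=p$. The value $B(p,q)$ does not depend on the choice of $C_p$, $C_q$. $\mathrm{Cl}(P,B)$ is the Clifford algebra of the (possibly degenerate) symmetric bilinear form $B$, i.e. the quotient of the tensor algebra of $P$ by the relations $pq+qp=2B(p,q)\cdot 1$. *)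

(* Defs.v *)
From HB Require Import structures.
From mathcomp Require Import all_boot all_algebra.
From mathcomp Require Import boolp classical_sets.
From mathcomp Require Import mpoly.
From mathcomp Require monalg.

Set Implicit Arguments.
Unset Strict Implicit.
Unset Printing Implicit Defensive.

Import GRing.Theory.
Local Open Scope classical_set_scope.
Local Open Scope ring_scope.
Local Open Scope quotient_scope.

Record ideal (k : fieldType) (A : algType k) := Ideal {
  ideal_set :> A -> Prop;
  ideal0 : ideal_set 0;
  idealB : forall x y, ideal_set x -> ideal_set y -> ideal_set (x - y);
  idealMl : forall a x, ideal_set x -> ideal_set (a * x);
  idealMr : forall a x, ideal_set x -> ideal_set (x * a)
}.

Section IdealTheory.
Context (k : fieldType) (A : algType k).
Implicit Types (I : ideal A) (X : set A).

Lemma idealN I x : I x -> I (- x).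
Proof. by rewrite -sub0r; apply: idealB; exact: ideal0. Qed.

Lemma idealD I x y : I x -> I y -> I (x + y).
Proof. by move=> Ix Iy; rewrite -[y]opprK; apply: idealB => //; apply: idealN. Qed.

Lemma idealZ I (a : k) x : I x -> I (a *: x).
Proof. by move=> Ix; rewrite -[x]mul1r scalerAl; apply: idealMl. Qed.

Definition ideal_gen_set X : set A :=
  [set x | forall I : ideal A, X `<=` ideal_set I -> I x].

Fact ideal_gen0 X : ideal_gen_set X 0.
Proof. by move=> I _; apply: ideal0. Qed.

Fact ideal_genB X x y :
  ideal_gen_set X x -> ideal_gen_set X y -> ideal_gen_set X (x - y).
Proof. by move=> hx hy I XI; apply: idealB; [apply: hx|apply: hy]. Qed.

Fact ideal_genMl X a x : ideal_gen_set X x -> ideal_gen_set X (a * x).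
Proof. by move=> hx I XI; apply: idealMl; apply: hx. Qed.

Fact ideal_genMr X a x : ideal_gen_set X x -> ideal_gen_set X (x * a).
Proof. by move=> hx I XI; apply: idealMr; apply: hx. Qed.

Definition ideal_gen X : ideal A :=
  Ideal (@ideal_gen0 X) (@ideal_genB X) (@ideal_genMl X) (@ideal_genMr X).

Lemma sub_ideal_gen X : X `<=` ideal_set (ideal_gen X).
Proof. by move=> x Xx I; apply. Qed.

End IdealTheory.

Section QuotientAlgebra.
Context (k : fieldType) (A : algType k) (I : ideal A).

Definition ideal_pred : {pred A} := fun x => `[< I x >].

Fact ideal_pred_zmod : zmod_closed ideal_pred.
Proof.
split=> [|x y]; rewrite !unfold_in; first by apply/asboolP; exact: ideal0.
by move=> /asboolP Ix /asboolP Iy; apply/asboolP; exact: idealB.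
Qed.
HB.instance Definition _ := GRing.isZmodClosed.Build A ideal_pred ideal_pred_zmod.

(* algType requires 1 != 0, so the quotient by an arbitrary ideal only gets    *)
(* ring and module structures; proper_quot below is an algType.                *)
Definition quot_alg : Type := {ideal_quot ideal_pred}.

HB.instance Definition _ := GRing.Zmodule.on quot_alg.
HB.instance Definition _ := EqQuotient.on quot_alg.

Definition quot_pi (x : A) : quot_alg := \pi_quot_alg x.

Lemma quot_piP (x y : A) : quot_pi x = quot_pi y <-> I (x - y).
Proof.
split=> [/eqP|h].
  by rewrite /quot_pi -Quotient.idealrBE unfold_in => /asboolP.
by apply/eqP; rewrite /quot_pi -Quotient.idealrBE unfold_in; apply/asboolP.
Qed.

Lemma quot_pi_repr (x : quot_alg) : quot_pi (repr x) = x.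
Proof. exact: reprK. Qed.

Lemma quot_pi_surj (x : quot_alg) : exists y, x = quot_pi y.
Proof. by exists (repr x); rewrite quot_pi_repr. Qed.

Fact quot_pi_zmod : zmod_morphism quot_pi.
Proof. by move=> x y; rewrite /quot_pi !piE. Qed.
HB.instance Definition _ := GRing.isZmodMorphism.Build A quot_alg quot_pi quot_pi_zmod.

Definition quot_one : quot_alg := quot_pi 1.
Definition quot_mul (x y : quot_alg) : quot_alg := quot_pi (repr x * repr y).
Definition quot_scale (a : k) (x : quot_alg) : quot_alg := quot_pi (a *: repr x).

Fact quot_repr x : I (repr (quot_pi x) - x).
Proof. by apply/quot_piP; rewrite quot_pi_repr. Qed.

Fact quot_mulE x y : quot_mul (quot_pi x) (quot_pi y) = quot_pi (x * y).
Proof.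
apply/quot_piP; set X := repr _; set Y := repr _.
have -> : X * Y - x * y = (X - x) * Y + x * (Y - y).
  by rewrite mulrBl mulrBr addrA subrK.
by apply: idealD; [apply: idealMr|apply: idealMl]; apply: quot_repr.
Qed.

Fact quot_scaleE a x : quot_scale a (quot_pi x) = quot_pi (a *: x).
Proof. by apply/quot_piP; rewrite -scalerBr; apply: idealZ; apply: quot_repr. Qed.

Local Ltac lift x := have [{}x ->] := quot_pi_surj x.

Fact quot_mulA : associative quot_mul.
Proof. by move=> x y z; lift x; lift y; lift z; rewrite !quot_mulE mulrA. Qed.
Fact quot_mul1 : left_id quot_one quot_mul.
Proof. by move=> x; lift x; rewrite quot_mulE mul1r. Qed.
Fact quot_mulr1 : right_id quot_one quot_mul.
Proof. by move=> x; lift x; rewrite quot_mulE mulr1. Qed.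
Fact quot_mulDl : left_distributive quot_mul +%R.
Proof.
by move=> x y z; lift x; lift y; lift z; rewrite -raddfD !quot_mulE mulrDl raddfD.
Qed.
Fact quot_mulDr : right_distributive quot_mul +%R.
Proof.
by move=> x y z; lift x; lift y; lift z; rewrite -raddfD !quot_mulE mulrDr raddfD.
Qed.
HB.instance Definition _ := GRing.Zmodule_isPzRing.Build quot_alg
  quot_mulA quot_mul1 quot_mulr1 quot_mulDl quot_mulDr.

Fact quot_scaleA a b x : quot_scale a (quot_scale b x) = quot_scale (a * b) x.
Proof. by lift x; rewrite !quot_scaleE scalerA. Qed.
Fact quot_scale1 : left_id 1 quot_scale.
Proof. by move=> x; lift x; rewrite quot_scaleE scale1r. Qed.
Fact quot_scaleDr : right_distributive quot_scale +%R.
Proof.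
by move=> a x y; lift x; lift y; rewrite -raddfD !quot_scaleE scalerDr raddfD.
Qed.
Fact quot_scaleDl x : {morph quot_scale^~ x : a b / a + b}.
Proof. by move=> a b; lift x; rewrite !quot_scaleE scalerDl raddfD. Qed.
HB.instance Definition _ := GRing.Zmodule_isLmodule.Build k quot_alg
  quot_scaleA quot_scale1 quot_scaleDr quot_scaleDl.

Lemma quot_pi1 : quot_pi 1 = 1. Proof. by []. Qed.
Lemma quot_piM x y : quot_pi (x * y) = quot_pi x * quot_pi y.
Proof. by rewrite -quot_mulE. Qed.
Lemma quot_piZ a x : quot_pi (a *: x) = a *: quot_pi x.
Proof. by rewrite -quot_scaleE. Qed.

Fact quot_scalerAl (a : k) (u v : quot_alg) : a *: (u * v) = (a *: u) * v.
Proof. by lift u; lift v; rewrite -(quot_piM u v) -!quot_piZ -quot_piM scalerAl. Qed.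
Fact quot_scalerAr (a : k) (u v : quot_alg) : a *: (u * v) = u * (a *: v).
Proof. by lift u; lift v; rewrite -(quot_piM u v) -!quot_piZ -quot_piM scalerAr. Qed.

End QuotientAlgebra.

Arguments quot_alg {k A} I.
Arguments quot_pi {k A} I x.

Section ProperQuotient.
Context (k : fieldType) (A : algType k) (I : ideal A) (I_proper : ~ I 1).

Definition proper_quot of ~ I 1 : Type := quot_alg I.
Local Notation Q := (proper_quot I_proper).

HB.instance Definition _ := GRing.PzRing.on Q.
HB.instance Definition _ := GRing.Lmodule.on Q.

Fact proper_quot_nonzero : (1 : Q) != 0.
Proof.
apply/eqP => h; apply: I_proper; rewrite -[1]subr0; apply/quot_piP.
by rewrite raddf0; exact: h.
Qed.
HB.instance Definition _ := GRing.PzSemiRing_isNonZero.Build Q proper_quot_nonzero.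
HB.instance Definition _ := GRing.Lmodule_isLalgebra.Build k Q
  (@quot_scalerAl k A I).
HB.instance Definition _ := GRing.Lalgebra_isAlgebra.Build k Q
  (@quot_scalerAr k A I).
End ProperQuotient.

(* hom false is the even part, hom true the odd part.                          *)
HB.mixin Record Algebra_isSuper (k : fieldType) A of GRing.Algebra k A := {
  hom : bool -> set A;
  hom0 : forall i, hom i 0;
  homP : forall i (a : k) (x y : A), hom i x -> hom i y -> hom i (a *: x + y);
  hom_dec : forall x : A, exists x_ : bool -> A,
    (forall i, hom i (x_ i)) /\ x = x_ false + x_ true;
  hom_disj : forall x : A, hom false x -> hom true x -> x = 0;
  hom1 : hom false 1;
  homM : forall i j (x y : A), hom i x -> hom j y -> hom (i (+) j) (x * y)
}.

#[short(type="superAlgType")]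
HB.structure Definition SuperAlg (k : fieldType) :=
  {A of GRing.Algebra k A & Algebra_isSuper k A}.

HB.mixin Record SuperAlg_isDiff (k : fieldType) A of SuperAlg k A := {
  diff : A -> A;
  diff_linear : linear diff;
  diff_odd : forall i (x : A), hom i x -> hom (~~ i) (diff x);
  diffM : forall i (x y : A), hom i x ->
    diff (x * y) = diff x * y + (-1) ^+ i * (x * diff y);
  diffK : forall x : A, diff (diff x) = 0
}.

#[short(type="diffAlgType")]
HB.structure Definition DiffAlg (k : fieldType) :=
  {A of SuperAlg k A & SuperAlg_isDiff k A}.

HB.instance Definition _ (k : fieldType) (W : diffAlgType k) :=
  GRing.isLinear.Build k W W *:%R (@diff k W) (@diff_linear k W).

Arguments homM {k s i j x y}.
Arguments homP {k s i} a {x y}.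
Arguments hom_disj {k s x}.
Arguments diff_odd {k s i x}.
Arguments diffM {k s i x} y.

Section SuperTheory.
Context (k : fieldType) (W : superAlgType k).
Implicit Types x y : W.

Lemma homD i x y : hom i x -> hom i y -> hom i (x + y).
Proof. by move=> hx hy; rewrite -[x]scale1r; apply: homP. Qed.
Lemma homZ i a x : hom i x -> hom i (a *: x).
Proof. by move=> hx; rewrite -[_ *: _]addr0; apply: homP => //; apply: hom0. Qed.
Lemma homN i x : hom i x -> hom i (- x).
Proof. by move=> hx; rewrite -scaleN1r; apply: homZ. Qed.
Lemma homX x n : hom false x -> hom false (x ^+ n).
Proof.
by move=> hx; elim: n => [|n IH]; [apply: hom1|rewrite exprS; apply: (homM hx IH)].
Qed.
Lemma hom_sum i T (s : seq T) (F : T -> W) :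
  (forall t, hom i (F t)) -> hom i (\sum_(t <- s) F t).
Proof. by move=> h; apply: big_ind => //; [apply: hom0|apply: homD]. Qed.
Lemma hom_prod T (s : seq T) (F : T -> W) :
  (forall t, hom false (F t)) -> hom false (\prod_(t <- s) F t).
Proof.
by move=> h; apply: big_ind => //; [apply: hom1|move=> x y; apply: (@homM _ _ false false)].
Qed.

Lemma hom_uniq (x0 x1 y0 y1 : W) : hom false x0 -> hom true x1 ->
  hom false y0 -> hom true y1 -> x0 + x1 = y0 + y1 -> x0 = y0 /\ x1 = y1.
Proof.
move=> hx0 hx1 hy0 hy1 e.
have e' : x0 - y0 = y1 - x1.
  by apply/eqP; rewrite subr_eq addrAC eq_sym subr_eq e addrC.
have z : x0 - y0 = 0.
  apply: hom_disj; first by apply: homD => //; apply: homN.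
  by rewrite e'; apply: homD => //; apply: homN.
by split; apply/eqP; rewrite -subr_eq0 ?z // -opprB -e' z oppr0.
Qed.

(* The homogeneous component of x of parity i.                                 *)
Definition hpart (i : bool) x : W := projT1 (cid (hom_dec x)) i.

Lemma hpart_hom i x : hom i (hpart i x).
Proof. by rewrite /hpart; case: cid => ? [/= ]. Qed.
Lemma hpartE x : x = hpart false x + hpart true x.
Proof. by rewrite {1}/hpart /hpart; case: cid => ? [/= ]. Qed.

(* Bilinear extension of [x, y] = x y - (-1)^(|x||y|) y x.                     *)
Definition super_bracket x y : W :=
  \sum_(i : bool) \sum_(j : bool)
    (hpart i x * hpart j y - (-1) ^+ (i && j) * (hpart j y * hpart i x)).

Definition super_center : set W := [set z | forall w, super_bracket z w = 0].

Definition even_center : set W := super_center `&` hom false.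

Lemma even_centerC (z : W) : even_center z -> forall w, z * w = w * z.
Proof.
move=> [zc z0] w.
have [e0 e1] : hpart false z = z /\ hpart true z = 0.
  apply: (hom_uniq (hpart_hom _ _) (hpart_hom _ _) z0 (hom0 true)).
  by rewrite addr0 -hpartE.
move: (zc w); rewrite /super_bracket !big_bool e0 e1 /=.
rewrite !(mul0r, mulr0, oppr0, add0r, mul1r) addrACA -opprD.
by rewrite -mulrDl -mulrDr [hpart true w + _]addrC -hpartE; apply: subr0_eq.
Qed.

End SuperTheory.

Section Cohomology.
Context (k : fieldType) (W : diffAlgType k).
Implicit Types x y : W.

Definition cocycle_pred : {pred W} := fun x => diff x == 0.

Lemma cocycle_hpart x : diff x = 0 ->
  diff (hpart false x) = 0 /\ diff (hpart true x) = 0.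
Proof.
move=> dx.
have e : diff (hpart true x) + diff (hpart false x) = 0 + 0.
  by rewrite addr0 -raddfD addrC -hpartE.
by have [-> ->] := hom_uniq (diff_odd (hpart_hom true x))
  (diff_odd (hpart_hom false x)) (hom0 _) (hom0 _) e.
Qed.

Lemma diff_homM i x y : hom i x -> diff x = 0 ->
  diff (x * y) = (-1) ^+ i * (x * diff y).
Proof. by move=> hx dx; rewrite (diffM _ hx) dx mul0r add0r. Qed.

Lemma diff1 : diff (1 : W) = 0.
Proof.
have := diffM (1 : W) (@hom1 k W).
rewrite mul1r mulr1 mul1r mul1r => h.
by apply: (addrI (diff (1 : W))); rewrite addr0 -h.
Qed.

Lemma diffMr x y : diff y = 0 -> diff (x * y) = diff x * y.
Proof.
move=> dy; rewrite {1 2}(hpartE x) mulrDl !raddfD /= mulrDl.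
by rewrite !(diffM _ (hpart_hom _ x)) dy !(mulr0, addr0).
Qed.

Fact cocycle_subsemialg : GRing.subsemialg_closed cocycle_pred.
Proof.
split.
- by rewrite unfold_in diff1.
- split=> [|x y]; rewrite !unfold_in ?raddf0 //.
  by move=> /eqP dx /eqP dy; rewrite raddfD /= dx dy addr0.
- by move=> a x; rewrite !unfold_in linearZ /= => /eqP ->; rewrite scaler0.
- by move=> x y; rewrite !unfold_in => /eqP dx /eqP dy; rewrite diffMr // dx mul0r.
Qed.

Record cocycle := Cocycle { cocycle_val : W; _ : cocycle_val \in cocycle_pred }.

HB.instance Definition _ := [isSub for cocycle_val].
HB.instance Definition _ := [Choice of cocycle by <:].
HB.instance Definition _ := GRing.SubChoice_isSubAlgebra.Build k W
  cocycle_pred cocycle cocycle_subsemialg.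

Lemma cocycleP (z : cocycle) : diff (val z) = 0.
Proof. by apply/eqP; apply: (valP z). Qed.

Definition coboundary : set W := [set x | exists y, diff y = x].

Definition cobound_set : set cocycle := [set z | coboundary (val z)].

Fact cobound0 : cobound_set 0.
Proof. by exists 0; rewrite raddf0. Qed.
Fact coboundB (x y : cocycle) : cobound_set x -> cobound_set y -> cobound_set (x - y).
Proof. by move=> [u hu] [v hv]; exists (u - v); rewrite raddfB /= hu hv. Qed.
Fact coboundMl (a x : cocycle) : cobound_set x -> cobound_set (a * x).
Proof.
move=> [u hu]; have [d0 d1] := cocycle_hpart (cocycleP a).
exists (hpart false (val a) * u - hpart true (val a) * u).
rewrite raddfB /= (diff_homM _ (hpart_hom false _)) //.
rewrite (diff_homM _ (hpart_hom true _)) // expr0 expr1 mul1r mulN1r opprK.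
by rewrite -mulrDl -hpartE hu.
Qed.
Fact coboundMr (a x : cocycle) : cobound_set x -> cobound_set (x * a).
Proof. by move=> [u hu]; exists (u * val a); rewrite diffMr ?cocycleP ?hu. Qed.

Definition cobound_ideal : ideal cocycle :=
  Ideal cobound0 coboundB coboundMl coboundMr.

Definition cohomology : Type := quot_alg cobound_ideal.
HB.instance Definition _ := GRing.PzRing.on cohomology.
HB.instance Definition _ := GRing.Lmodule.on cohomology.

(* diff x = 0 and h = [x]_d.                                                   *)
Definition is_class x (h : cohomology) : Prop :=
  exists2 z : cocycle, val z = x & h = quot_pi cobound_ideal z.

Definition trivial_cohomology : Prop :=
  (1 : cohomology) <> 0 /\ forall h : cohomology, exists a : k, h = a *: (1 : cohomology).

Definition transgression (p C : W) : Prop := hom true C /\ diff C = p.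

End Cohomology.

Record diff_ideal (k : fieldType) (W : diffAlgType k) := DiffIdeal {
  diff_ideal_ideal :> ideal W;
  diff_ideal_proper : ~ diff_ideal_ideal 1;
  diff_ideal_hpart : forall i x, diff_ideal_ideal x -> diff_ideal_ideal (hpart i x);
  diff_ideal_diff : forall x, diff_ideal_ideal x -> diff_ideal_ideal (diff x)
}.

Section DiffQuotient.
Context (k : fieldType) (W : diffAlgType k) (I : diff_ideal W).

Definition diff_quot : Type := proper_quot (@diff_ideal_proper _ _ I).
HB.instance Definition _ := GRing.Algebra.on diff_quot.

Local Notation pi := (quot_pi I : W -> diff_quot).

Definition quot_hom i : set diff_quot := [set pi x | x in hom i].

Fact quot_hom0 i : quot_hom i 0.
Proof. by exists 0; [apply: hom0|rewrite raddf0]. Qed.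
Fact quot_homP i (a : k) (x y : diff_quot) :
  quot_hom i x -> quot_hom i y -> quot_hom i (a *: x + y).
Proof.
move=> [u hu <-] [v hv <-]; exists (a *: u + v); first exact: homP.
by rewrite raddfD /= quot_piZ.
Qed.
Fact quot_hom_dec (x : diff_quot) : exists x_ : bool -> diff_quot,
  (forall i, quot_hom i (x_ i)) /\ x = x_ false + x_ true.
Proof.
have [u ->] := quot_pi_surj x; exists (fun i => pi (hpart i u)); split.
  by move=> i; exists (hpart i u) => //; apply: hpart_hom.
by rewrite -raddfD -hpartE.
Qed.
Fact quot_hom_disj (x : diff_quot) :
  quot_hom false x -> quot_hom true x -> x = 0.
Proof.
move=> [u hu <-] [v hv /quot_piP vu].
have := diff_ideal_hpart false (idealN vu).
have e : hpart false (- (v - u)) + hpart true (- (v - u)) = u - v.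
  by rewrite -hpartE opprB.
have [-> _] := hom_uniq (hpart_hom _ _) (hpart_hom _ _) hu (homN hv) e.
by move=> Iu; rewrite -(raddf0 pi); apply/quot_piP; rewrite subr0.
Qed.
Fact quot_hom1 : quot_hom false 1.
Proof. by exists 1; [apply: hom1|]. Qed.
Fact quot_homM i j (x y : diff_quot) :
  quot_hom i x -> quot_hom j y -> quot_hom (i (+) j) (x * y).
Proof.
move=> [u hu <-] [v hv <-]; exists (u * v); first exact: homM.
exact: quot_piM.
Qed.
HB.instance Definition _ := Algebra_isSuper.Build k diff_quot
  quot_hom0 quot_homP quot_hom_dec quot_hom_disj quot_hom1 quot_homM.

Definition quot_diff (x : diff_quot) : diff_quot := pi (diff (repr x)).

Fact quot_diffE x : quot_diff (pi x) = pi (diff x).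
Proof.
by apply/quot_piP; rewrite -raddfB; apply: diff_ideal_diff; apply: quot_repr.
Qed.
Fact quot_diff_linear : linear quot_diff.
Proof.
move=> a x y; have [u ->] := quot_pi_surj x; have [v ->] := quot_pi_surj y.
have -> : a *: pi u + pi v = pi (a *: u + v) by rewrite raddfD /= quot_piZ.
by rewrite !quot_diffE linearP raddfD /= quot_piZ.
Qed.
Fact quot_diff_odd i (x : diff_quot) : hom i x -> hom (~~ i) (quot_diff x).
Proof.
move=> [u hu <-]; rewrite quot_diffE; exists (diff u) => //.
exact: diff_odd.
Qed.
Fact quot_diffM i (x y : diff_quot) : hom i x ->
  quot_diff (x * y) = quot_diff x * y + (-1) ^+ i * (x * quot_diff y).
Proof.
move=> [u hu <-]; have [v ->] := quot_pi_surj y.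
have -> : pi u * pi v = pi (u * v) by rewrite quot_piM.
rewrite !quot_diffE (diffM _ hu) raddfD /= !quot_piM; congr (_ + _ * _).
by case: (i); rewrite ?expr0 ?expr1 ?raddfN.
Qed.
Fact quot_diffK (x : diff_quot) : quot_diff (quot_diff x) = 0.
Proof.
by have [u ->] := quot_pi_surj x; rewrite !quot_diffE diffK raddf0.
Qed.
HB.instance Definition _ := SuperAlg_isDiff.Build k diff_quot
  quot_diff_linear quot_diff_odd quot_diffM quot_diffK.

End DiffQuotient.

Section TensorAlgebra.
Import monalg.
Context (k : fieldType) (V : lmodType k).

(* The free algebra on the underlying set of V; T(V) is its quotient by the    *)
(* relations making V -> T(V) linear.                                          *)
Definition free_alg : Type := {malg k[{fmonom V}]}.
HB.instance Definition _ := GRing.Lalgebra.on free_alg.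

Fact free_alg_scalerAr (a : k) (u v : free_alg) : a *: (u * v) = u * (a *: v).
Proof.
apply/malgP => m; rewrite mcoeffZ mcoeffMl mulr_sumr.
have sub := msuppZ_le a v.
rewrite (mcoeffMlw m (finmap.fsubset_refl _) sub); apply: eq_bigr => x _.
rewrite mulr_sumr; apply: eq_bigr => y _.
by rewrite mcoeffZ mulrnAr mulrCA.
Qed.
HB.instance Definition _ := GRing.Lalgebra_isAlgebra.Build k free_alg
  free_alg_scalerAr.

Definition free_gen (v : V) : free_alg := mkmalgU (fmu v) 1.

Definition tensor_rel : set free_alg :=
  [set t | exists (a : k) (u v : V),
     t = free_gen (a *: u + v) - (a *: free_gen u + free_gen v)].

Definition tensor_ideal : ideal free_alg := ideal_gen tensor_rel.

Fact tensor_proper : ~ tensor_ideal 1.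
Proof.
pose e (x : free_alg) : k := mcoeff (mone : fmonom V) x.
have eB x y : e (x - y) = e x - e y by rewrite /e raddfB.
have eM x y : e (x * y) = e x * e y by exact: rmorphM.
have e0 : e 0 = 0 by rewrite /e raddf0.
have egen v : e (free_gen v) = 0.
  rewrite /e /free_gen mcoeffU; case: eqP => // h.
  by have := congr1 (@fmonom_val V) h; rewrite fmuE fm1.
have K0B x y : e x = 0 -> e y = 0 -> e (x - y) = 0.
  by move=> hx hy; rewrite eB hx hy subrr.
have K0Ml a x : e x = 0 -> e (a * x) = 0 by move=> hx; rewrite eM hx mulr0.
have K0Mr a x : e x = 0 -> e (x * a) = 0 by move=> hx; rewrite eM hx mul0r.
pose K := @Ideal k free_alg (fun x => e x = 0) e0 K0B K0Ml K0Mr.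
have e1 : e 1 = 1 by exact: rmorph1.
move=> /(_ K) h; have := oner_eq0 k; rewrite -e1 h ?eqxx //.
move=> _ [a [u [v ->]]] /=; rewrite eB egen sub0r; apply/eqP; rewrite oppr_eq0.
by rewrite /e mcoeffD mcoeffZ -!/(e _) !egen mulr0 addr0.
Qed.

Definition tensor_alg : Type := proper_quot tensor_proper.
HB.instance Definition _ := GRing.Algebra.on tensor_alg.

Definition tensor_gen (v : V) : tensor_alg := quot_pi tensor_ideal (free_gen v).

End TensorAlgebra.

Section Clifford.
Context (k : fieldType) (V : lmodType k).
Implicit Types u v : V.
Context (B : {symmetric V}).

Definition clifford_rel : set (tensor_alg V) :=
  [set t | exists u v : V,
     t = tensor_gen u * tensor_gen v + tensor_gen v * tensor_gen u
         - (2 * B u v) *: 1].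

Definition clifford : Type := quot_alg (ideal_gen clifford_rel).
HB.instance Definition _ := GRing.PzRing.on clifford.
HB.instance Definition _ := GRing.Lmodule.on clifford.

Definition clifford_gen (v : V) : clifford :=
  quot_pi (ideal_gen clifford_rel) (tensor_gen v).

End Clifford.

Section Subspace.
Context (k : fieldType) (V : lmodType k) (r : nat) (p : 'I_r -> V).

Definition lin_indep : Prop :=
  forall c : 'I_r -> k, \sum_i c i *: p i = 0 -> forall i, c i = 0.

Definition lspan_pred : {pred V} :=
  fun x => `[< exists c : 'I_r -> k, x = \sum_i c i *: p i >].

Record lspan := Lspan { lspan_val : V; _ : lspan_val \in lspan_pred }.

HB.instance Definition _ := [isSub for lspan_val].
HB.instance Definition _ := [Choice of lspan by <:].

Fact lspan_submod : submod_closed lspan_pred.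
Proof.
split=> [|a x y].
  rewrite unfold_in; apply/asboolP; exists (fun=> 0).
  by rewrite big1 // => i _; rewrite scale0r.
rewrite !unfold_in => /asboolP[c ->] /asboolP[e ->]; apply/asboolP.
exists (fun i => a * c i + e i); rewrite scaler_sumr -big_split /=.
by apply: eq_bigr => i _; rewrite scalerDl scalerA.
Qed.
HB.instance Definition _ := GRing.isSubmodClosed.Build k V lspan_pred lspan_submod.
HB.instance Definition _ := [SubChoice_isSubLmodule of lspan by <:].

End Subspace.

Section PolynomialSubalgebra.
Context (k : fieldType) (W : diffAlgType k) (r : nat) (p : 'I_r -> W).

Definition subalgebra (S : set W) : Prop :=
  [/\ S 1, forall (a : k) x y, S x -> S y -> S (a *: x + y)
    & forall x y, S x -> S y -> S (x * y)].

Definition subalg_gen (X : set W) : set W :=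
  [set x | forall S, subalgebra S -> X `<=` S -> S x].

Definition poly_eval (q : {mpoly k[r]}) : W := mmap (in_alg W) p q.

Definition SP : set W := subalg_gen (range p).

(* Evaluation at p identifies k[X_1, ..., X_r] with the subalgebra SP.         *)
Definition SP_polynomial : Prop :=
  injective poly_eval /\ range poly_eval = SP.

(* The kernel of the augmentation p i |-> 0 of SP, read off on polynomials.    *)
Definition SP_aug : set W := [set poly_eval q | q in [set q | q.@[fun=> 0] = 0]].

(* e is a basis of W as a left S-module; c ranges over families in S.          *)
Definition free_module (S : set W) : Prop :=
  exists (I : choiceType) (e : I -> W),
    (forall w, exists (s : seq I) (c : I -> W),
       (forall i, S (c i)) /\ w = \sum_(i <- s) c i * e i) /\
    (forall (s : seq I) (c : I -> W), uniq s -> (forall i, S (c i)) ->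
       \sum_(i <- s) c i * e i = 0 -> forall i, i \in s -> c i = 0).

Hypothesis pZ : forall i, even_center (p i).
Hypothesis p_cob : forall i, coboundary (p i).

Fact diff_p i : diff (p i) = 0.
Proof. by have [y <-] := p_cob i; apply: diffK. Qed.

Fact hom_poly_eval q : hom false (poly_eval q).
Proof.
apply: hom_sum => m; rewrite mulr_algl; apply: homZ; apply: hom_prod => i; apply: homX.
by have [] := pZ i.
Qed.

Fact diff_poly_eval q : diff (poly_eval q) = 0.
Proof.
rewrite /poly_eval /mmap raddf_sum big1 // => m _; rewrite /= mulr_algl linearZ /=.
suff -> : diff (\prod_(i < r) p i ^+ m i) = 0 by rewrite scaler0.
apply: (big_ind (fun x : W => diff x = 0)); first exact: diff1.
  by move=> x y dx dy; rewrite diffMr // dx mul0r.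
move=> i _; elim: (m i) => [|n IH]; first exact: diff1.
by rewrite exprS diffMr // diff_p mul0r.
Qed.

Fact SP_aug_stable :
  let J := [set x | forall i, ideal_gen SP_aug (hpart i x) /\
                              ideal_gen SP_aug (diff (hpart i x))] in
  ideal_set (ideal_gen SP_aug) `<=` J.
Proof.
move=> J; set I := ideal_gen SP_aug.
pose J' := [set x : W | exists x_ : bool -> W, [/\ forall i, hom i (x_ i),
   forall i, I (x_ i), forall i, I (diff (x_ i)) & x = x_ false + x_ true]].
have J'0 : J' 0.
  by exists (fun=> 0); split=> [i|i|i|]; rewrite ?raddf0 ?addr0 //;
    [apply: hom0|apply: ideal0|apply: ideal0].
have J'B x y : J' x -> J' y -> J' (x - y).
  move=> [u [hu Iu du ->]] [v [hv Iv dv ->]]; exists (fun i => u i - v i).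
  split=> [i|i|i|]; last by rewrite opprD addrACA.
  - exact: homD (hu i) (homN (hv i)).
  - exact: idealB (Iu i) (Iv i).
  - by rewrite raddfB; exact: idealB (du i) (dv i).
have J'D x y : J' x -> J' y -> J' (x + y).
  by move=> Jx Jy; rewrite -[y]opprK -[- y]sub0r; apply: (J'B) => //; apply: J'B.
have J'h i x : hom i x -> I x -> I (diff x) -> J' x.
  move=> hx Ix dx; exists (fun j => if j == i then x else 0).
  split=> [j|j|j|].
  - by case: eqP => [->//|_]; apply: hom0.
  - by case: eqP => [_//|_]; apply: ideal0.
  - by case: eqP => [_//|_]; rewrite raddf0; apply: ideal0.
  - by case: (i); rewrite /= ?addr0 ?add0r.
have signI (i : bool) x : I x -> I ((-1) ^+ i * x).
  by move=> Ix; apply: idealMl.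
have J'hMl i j a x : hom i a -> hom j x -> I x -> I (diff x) -> J' (a * x).
  move=> ha hx Ix dx; apply: (J'h (i (+) j)); first exact: homM.
    exact: idealMl.
  rewrite (diffM _ ha); apply: idealD; first exact: idealMl.
  by apply: signI; apply: idealMl.
have J'hMr i j a x : hom i a -> hom j x -> I x -> I (diff x) -> J' (x * a).
  move=> ha hx Ix dx; apply: (J'h (j (+) i)); first exact: homM.
    exact: idealMr.
  rewrite (diffM _ hx); apply: idealD; first exact: idealMr.
  by apply: signI; apply: idealMr.
have J'Ml a x : J' x -> J' (a * x).
  move=> [u [hu Iu du ->]]; rewrite (hpartE a) mulrDl !mulrDr.
  have Jij i j : J' (hpart i a * u j) by exact: J'hMl (hpart_hom i a) (hu j) (Iu j) (du j).
  exact: J'D (J'D _ _ (Jij _ _) (Jij _ _)) (J'D _ _ (Jij _ _) (Jij _ _)).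
have J'Mr a x : J' x -> J' (x * a).
  move=> [u [hu Iu du ->]]; rewrite (hpartE a) mulrDl !mulrDr.
  have Jij i j : J' (u j * hpart i a) by exact: J'hMr (hpart_hom i a) (hu j) (Iu j) (du j).
  exact: J'D (J'D _ _ (Jij _ _) (Jij _ _)) (J'D _ _ (Jij _ _) (Jij _ _)).
move=> x Ix i.
have : J' x.
  apply: (Ix (Ideal J'0 J'B J'Ml J'Mr)) => _ [q hq <-] /=.
  apply: (J'h false); first exact: hom_poly_eval.
    by apply: sub_ideal_gen; exists q.
  by rewrite diff_poly_eval; apply: ideal0.
move=> [u [hu Iu du e]].
have [e0 e1] := hom_uniq (hpart_hom _ _) (hpart_hom _ _) (hu _) (hu _)
  (etrans (esym (hpartE x)) e).
by case: i; rewrite ?e0 ?e1.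
Qed.

Fact SP_ideal_hpart i x :
  ideal_gen SP_aug x -> ideal_gen SP_aug (hpart i x).
Proof. by move=> /SP_aug_stable /(_ i) []. Qed.

Fact SP_ideal_diff x : ideal_gen SP_aug x -> ideal_gen SP_aug (diff x).
Proof.
move=> /SP_aug_stable h; rewrite (hpartE x) raddfD /=.
have [_ h0] := h false; have [_ h1] := h true; exact: idealD h0 h1.
Qed.

Hypothesis SP_poly : SP_polynomial.
Hypothesis SP_free : free_module SP.

Fact poly_evalM q1 q2 : poly_eval (q1 * q2) = poly_eval q1 * poly_eval q2.
Proof.
apply: (commr_mmap_is_multiplicative _ _).1 => [i x|q m m'].
  by rewrite /GRing.comm (even_centerC (pZ i)).
by rewrite /GRing.comm /= mulr_algl mulr_algr.
Qed.

Fact poly_evalB q1 q2 : poly_eval (q1 - q2) = poly_eval q1 - poly_eval q2.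
Proof. exact: raddfB. Qed.

Fact poly_eval1 : poly_eval 1 = 1.
Proof.
by have := mmapC p (in_alg W) (1 : k); rewrite mpolyC1 /= scale1r.
Qed.

Fact poly_evalC q w : poly_eval q * w = w * poly_eval q.
Proof.
rewrite /poly_eval /mmap mulr_suml mulr_sumr; apply: eq_bigr => m _ /=.
rewrite mulr_algl -scalerAl -scalerAr; congr (_ *: _).
rewrite /mmap1; apply: (big_ind (fun x : W => x * w = w * x)).
- by rewrite mul1r mulr1.
- by move=> x y hx hy; rewrite -mulrA hy mulrA hx mulrA.
move=> i _; elim: (m i) => [|n IH]; first by rewrite !expr0 mul1r mulr1.
by rewrite exprS -mulrA IH mulrA (even_centerC (pZ i)) mulrA.
Qed.

Fact SP_proper : ~ ideal_gen SP_aug 1.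
Proof.
have [inj SPE] := SP_poly; have [I [e [span indep]]] := SP_free.
have SPP x : SP x -> exists q, x = poly_eval q.
  by rewrite -SPE => -[q _ <-]; exists q.
have SPev q : SP (poly_eval q) by rewrite -SPE; exists q.
have aug0 : SP_aug 0.
  by exists 0; rewrite /= ?meval0 // /poly_eval raddf0.
have augB x y : SP_aug x -> SP_aug y -> SP_aug (x - y).
  move=> [q hq <-] [q' hq' <-]; exists (q - q'); last exact: poly_evalB.
  by move: hq hq'; rewrite /= mevalB => -> ->; rewrite subrr.
have augM x y : SP_aug x -> SP y -> SP_aug (x * y).
  move=> [q hq <-] /SPP[q' ->]; exists (q * q'); last exact: poly_evalM.
  by move: hq; rewrite /= mevalM => ->; rewrite mul0r.
have augC x w : SP_aug x -> x * w = w * x.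
  by move=> [q _ <-]; apply: poly_evalC.
pose comb (s : seq I) (c : I -> W) x :=
  [/\ uniq s, forall i, SP_aug (c i), forall i, i \notin s -> c i = 0
    & x = \sum_(i <- s) c i * e i].
have widen s t c x : comb s c x -> uniq t -> {subset s <= t} -> comb t c x.
  move=> [us ac c0 ->] ut st; split=> // [i it|].
    by apply: c0; apply: contra it; apply: st.
  rewrite [RHS](bigID (fun i => i \in s)) /= [X in _ = _ + X]big1; last first.
    by move=> i /c0 ->; rewrite mul0r.
  rewrite addr0 -[RHS]big_filter; apply: perm_big; apply: uniq_perm => //.
    exact: filter_uniq.
  by move=> i; rewrite mem_filter; case: (boolP (i \in s)) => //= /st ->.
pose K x := exists s c, comb s c x.
have K0 : K 0.
  by exists [::], (fun=> 0); split=> //; rewrite big_nil.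
have KB x y : K x -> K y -> K (x - y).
  move=> [s [c hc]] [t [d hd]]; exists (undup (s ++ t)), (fun i => c i - d i).
  have ss i : i \in s -> i \in undup (s ++ t) by rewrite mem_undup mem_cat => ->.
  have tt i : i \in t -> i \in undup (s ++ t).
    by rewrite mem_undup mem_cat orbC => ->.
  have [_ ac c0 ->] := widen _ _ _ _ hc (undup_uniq _) ss.
  have [_ ad d0 ->] := widen _ _ _ _ hd (undup_uniq _) tt.
  split=> [|i|i it|]; [exact: undup_uniq|exact: augB|by rewrite c0 ?d0 ?subrr|].
  by rewrite -sumrB; apply: eq_bigr => i _; rewrite mulrBl.
have KD x y : K x -> K y -> K (x + y).
  by move=> Kx Ky; rewrite -[y]opprK -[- y]sub0r; exact: KB Kx (KB _ _ K0 Ky).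
have K1 x i : SP_aug x -> K (x * e i).
  move=> ax; exists [:: i], (fun j => if j == i then x else 0); split=> //.
  - by move=> j; case: eqP.
  - by move=> j; rewrite inE => /negPf ->.
  - by rewrite big_seq1 eqxx.
have Kmul x w : SP_aug x -> K (x * w).
  move=> ax; have [s [c [SPc ->]]] := span w; rewrite mulr_sumr.
  by apply: big_ind => // i _; rewrite mulrA; apply: K1; apply: augM.
have KMl a x : K x -> K (a * x).
  move=> [s [c [_ ac _ ->]]]; rewrite mulr_sumr; apply: big_ind => // i _.
  by rewrite mulrA -(augC _ a (ac i)) -mulrA; apply: Kmul.
have KMr a x : K x -> K (x * a).
  move=> [s [c [_ ac _ ->]]]; rewrite mulr_suml; apply: big_ind => // i _.
  by rewrite -mulrA; apply: Kmul.
move=> /(_ (@Ideal k W K K0 KB KMl KMr)) /= h.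
have {h} Kone : K 1.
  by apply: h => x ax; rewrite /= -[x]mulr1; apply: Kmul.
have [s [c [_ _ _]]] := Kone.
case: s => [|i0 s _]; first by rewrite big_nil => /eqP; rewrite oner_eq0.
have [t [d hd]] := KMl (e i0) _ Kone; rewrite mulr1 in hd.
set u := undup (i0 :: t).
have uu : uniq u by exact: undup_uniq.
have i0u : i0 \in u by rewrite mem_undup mem_head.
have tu : {subset t <= u} by move=> i it; rewrite mem_undup inE it orbT.
have [_ ad _ eE] := widen _ _ _ _ hd uu tu.
have : d i0 - 1 = 0.
  have := indep u (fun i => d i - (i == i0)%:R) uu _ _ i0 i0u.
  rewrite eqxx; apply.
    move=> i; have [q _ <-] := ad i; case: eqP => _.
      by rewrite mulr1n -poly_eval1 -poly_evalB.
    by rewrite subr0.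
  rewrite (eq_bigr (fun i => d i * e i - (i == i0)%:R * e i)); last first.
    by move=> i _; rewrite mulrBl.
  rewrite sumrB -eE (bigD1_seq i0) //= eqxx mul1r big1 ?addr0 ?subrr //.
  by move=> i /negPf ->; rewrite mul0r.
move=> /eqP; rewrite subr_eq0 => /eqP d1.
have [q hq] := ad i0; rewrite d1 -poly_eval1 => /inj q1.
by move: hq => /=; rewrite q1 meval1 => /eqP; rewrite oner_eq0.
Qed.

(* Evenness and the coboundary condition make the ideal graded and stable      *)
(* under diff; polynomiality and freeness only serve to show that it is proper.*)
Definition SP_ideal : diff_ideal W :=
  @DiffIdeal k W (ideal_gen SP_aug) SP_proper SP_ideal_hpart SP_ideal_diff.

End PolynomialSubalgebra.

(* Main.v *)
(* Freeness makes p_1, ..., p_r a regular sequence on W. For W_j the quotient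
   of W by the ideal (p_1, ..., p_j), the exact sequence
     0 -> W_(j-1) --p_j--> W_(j-1) -> W_j -> 0
   splits in cohomology, because p_j = d C_j acts by zero there, so that
     H(W_j) = H(W_(j-1)) + [C_j] H(W_(j-1)),
   a direct sum of two copies of H(W_(j-1)). By induction the ordered monomials
   in the [C_i] form a basis of H(W_r). The map from Cl(P, B) sends the ordered
   monomials in the p_i, which span Cl(P, B), to this basis, hence it is
   bijective. *)

From HB Require Import structures.
Require Import Defs.
From mathcomp Require Import all_boot all_algebra.
From mathcomp Require Import boolp classical_sets mpoly.

Set Implicit Arguments.
Unset Strict Implicit.
Unset Printing Implicit Defensive.

Import GRing.Theory.
Local Open Scope ring_scope.

(** * Sums of ordered monomials *)

Section OrderedSums.
Context (k : fieldType).

(* The sum of the a b g^b over b in {0,1}^n, where g^b multiplies the g i in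
   decreasing order of i and the head of b is the exponent of g n.-1; iota
   embeds the scalars. *)
Fixpoint ordsum (A : pzRingType) (iota : k -> A) (g : nat -> A) n
    (a : seq bool -> k) : A :=
  if n is m.+1 then
    ordsum iota g m (a \o cons false) + g m * ordsum iota g m (a \o cons true)
  else iota (a [::]).

(** Stated for bare functions, so that it applies to the comparison map out of the Clifford algebra,
    which is known only through its equations. *)
Lemma ordsum_morph (A A' : pzRingType) (iota : k -> A) (iota' : k -> A')
    (g : nat -> A) (g' : nat -> A') (F : A -> A') n a :
    {morph F : x y / x + y} -> {morph F : x y / x * y} ->
    (forall c, F (iota c) = iota' c) -> (forall i, F (g i) = g' i) ->
  F (ordsum iota g n a) = ordsum iota' g' n a.
Proof.
move=> FD FM Fi Fg; elim: n a => [|n IH] a /=; first exact: Fi.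
by rewrite FD FM Fg !IH.
Qed.

Context (A : pzRingType) (iota : k -> A) (g : nat -> A).
Hypothesis iotaD : {morph iota : x y / x + y}.
Hypothesis iotaM : {morph iota : x y / x * y}.
Hypothesis iotaC : forall c x, iota c * x = x * iota c.

Local Notation osum := (ordsum iota g).

(** The recursion reads [a] only on lists of length [n], so vanishing there suffices. *)
Lemma ordsum0 n a : (forall b, size b = n -> a b = 0) -> osum n a = 0.
Proof.
have i0 : iota 0 = 0 by apply: (addrI (iota 0)); rewrite -iotaD !addr0.
elim: n a => [|n IH] a a0 /=; first by rewrite a0.
by rewrite !IH ?mulr0 ?addr0 // => b sb; apply: a0; rewrite /= sb.
Qed.

Lemma ordsumD n a a' :
  osum n a + osum n a' = osum n (fun b => a b + a' b).
Proof.
elim: n a a' => [|n IH] a a' /=; first by rewrite iotaD.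
by rewrite addrACA -mulrDr !IH.
Qed.

Lemma ordsumZ n c a : iota c * osum n a = osum n (fun b => c * a b).
Proof.
elim: n a => [|n IH] a /=; first by rewrite iotaM.
by rewrite mulrDr mulrA (iotaC c (g n)) -mulrA !IH.
Qed.

(** Anticommutation moves [g i] to the right past the higher generators until it meets its own
    power, where the square is a scalar. In the Clifford algebra [s j] is B(e_j, e_j) and [q i j] is
    2 B(e_i, e_j). *)
Lemma ordsum_mul n (s : nat -> k) (q : nat -> nat -> k) i a :
    (forall j, g j * g j = iota (s j)) ->
    (forall i j, g i * g j = iota (q i j) - g j * g i) ->
    iota 1 = 1 -> (i < n)%N ->
  exists a', g i * osum n a = osum n a'.
Proof.
move=> gg gC i1; elim: n i a => [//|n IH] i a.
rewrite ltnS leq_eqVlt => /predU1P[->|lt_in] /=.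
  (* g_n (S_0 + g_n S_1) = s_n S_1 + g_n S_0: the two halves of the coefficients trade places. *)
  exists (fun b => if b is c :: b' then
    (if c then a (false :: b') else s n * a (true :: b')) else 0) => /=.
  by rewrite mulrDr mulrA gg addrC ordsumZ.
have [a1 e1] := IH i (a \o cons false) lt_in.
have [a2 e2] := IH i (a \o cons true) lt_in.
(* g_i (S_0 + g_n S_1) = (g_i S_0 + q_in S_1) - g_n (g_i S_1), with [a1] and [a2] the coefficients
   of g_i S_0 and g_i S_1. *)
exists (fun b => if b is c :: b' then
    (if c then -1 * a2 b' else a1 b' + q i n * a (true :: b')) else 0) => /=.
rewrite mulrDr e1 mulrA gC mulrBl -mulrA e2 ordsumZ addrA ordsumD.
congr (_ + _); rewrite -mulrN; congr (_ * _).
transitivity (iota (-1) * osum n a2); last by rewrite ordsumZ.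
suff -> : iota (-1) = -1 by rewrite mulN1r.
have i0 : iota 0 = 0 by apply: (addrI (iota 0)); rewrite -iotaD !addr0.
by apply: (addrI (iota 1)); rewrite -iotaD addrN i0 i1 addrN.
Qed.

Lemma ordsum1 n : iota 1 = 1 -> exists a, 1 = osum n a.
Proof.
move=> i1; elim: n => [|n [a e]]; first by exists (fun=> 1).
exists (fun b => if b is false :: b' then a b' else 0) => /=.
by rewrite -[osum n (_ \o cons false)]e ordsum0 ?mulr0 ?addr0.
Qed.

End OrderedSums.

(** * Trivial cohomology, read on representatives *)

Section TrivialCohomology.
Context (k : fieldType) (W : diffAlgType k).
Hypothesis W_triv : trivial_cohomology W.

Lemma closed_scalar w : diff w = 0 -> exists a, coboundary (w - a *: (1 : W)).
Proof.
move=> dw0; have zc : w \in @cocycle_pred k W by rewrite unfold_in; apply/eqP.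
have [c] := W_triv.2 (quot_pi (cobound_ideal W) (Cocycle zc)).
by rewrite -quot_pi1 -quot_piZ => /quot_piP[y /= ey]; exists c, y.
Qed.

Lemma coboundary_scalar a : coboundary (a *: (1 : W)) -> a = 0.
Proof.
move=> [y dy]; apply/eqP/negP => /negP a0; apply: W_triv.1.
rewrite -quot_pi1 -(raddf0 (quot_pi (cobound_ideal W))); apply/quot_piP.
exists (a^-1 *: y); rewrite linearZ /= dy subr0.
by rewrite scalerA mulVf // scale1r.
Qed.

End TrivialCohomology.

(** * Cohomology of the quotient by a regular sequence *)

Section RegularSequence.
Context (k : fieldType) (W : diffAlgType k).
Context (P C : nat -> W).
Hypothesis PC : forall n w, P n * w = w * P n.
Hypothesis C_odd : forall n, Defs.hom true (C n).
Hypothesis dC : forall n, diff (C n) = P n.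


(* The ideal P 0 W + ... + P n.-1 W. *)
Fixpoint seq_ideal n (w : W) : Prop :=
  if n is m.+1 then exists u, seq_ideal m (w - P m * u) else w = 0.

Lemma seq_ideal0 n : seq_ideal n 0.
Proof.
by elim: n => [//|n IH]; exists 0; rewrite mulr0 subr0.
Qed.

Lemma seq_idealB n x y : seq_ideal n x -> seq_ideal n y -> seq_ideal n (x - y).
Proof.
elim: n x y => [|n IH] x y /=; first by move=> -> ->; rewrite subrr.
move=> [u hu] [v hv]; exists (u - v).
rewrite mulrBr opprB [_ - P n * u]addrC addrACA [- y + _]addrC -(opprB y).
exact: IH.
Qed.

Lemma seq_idealMl n a x : seq_ideal n x -> seq_ideal n (a * x).
Proof.
elim: n x => [|n IH] x /=; first by move=> ->; rewrite mulr0.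
move=> [u hu]; exists (a * u).
by rewrite mulrA PC -mulrA -mulrBr; apply: IH.
Qed.

Lemma seq_idealMr n a x : seq_ideal n x -> seq_ideal n (x * a).
Proof.
elim: n x => [|n IH] x /=; first by move=> ->; rewrite mul0r.
by move=> [u hu]; exists (u * a); rewrite mulrA -mulrBl; apply: IH.
Qed.

Definition seqI n : ideal W :=
  Ideal (seq_ideal0 n) (@seq_idealB n) (@seq_idealMl n) (@seq_idealMr n).

Lemma seqISP n x : seqI n.+1 x <-> exists u, seqI n (x - P n * u).
Proof. by []. Qed.

Lemma seqI_P n i u : (i < n)%N -> seqI n (P i * u).
Proof.
elim: n i => [//|n IH] i; rewrite ltnS leq_eqVlt => /predU1P[->|lt_in] /=.
  by exists u; rewrite subrr; apply: seq_ideal0.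
by exists 0; rewrite mulr0 subr0; apply: IH.
Qed.

Lemma seqIS n x : seqI n x -> seqI n.+1 x.
Proof. by move=> Jx; exists 0; rewrite mulr0 subr0. Qed.

Let diffB (x y : W) : diff (x - y) = diff x - diff y. Proof. exact: raddfB. Qed.
Let diffD (x y : W) : diff (x + y) = diff x + diff y. Proof. exact: raddfD. Qed.

Lemma diff_P n w : diff (P n * w) = P n * diff w.
Proof. by rewrite PC diffMr ?PC // -dC diffK. Qed.

Lemma diff_C n w : diff (C n * w) = P n * w - C n * diff w.
Proof. by rewrite (diffM w (C_odd n)) dC expr1 mulN1r. Qed.

Lemma seqI_diff n x : seqI n x -> seqI n (diff x).
Proof.
elim: n x => [|n IH] x /=; first by move=> ->; rewrite raddf0.
by move=> [u hu]; exists (diff u); rewrite -diff_P -raddfB; apply: IH.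
Qed.

Local Notation osum := (ordsum (in_alg W) C).

(** Each d C_i = P_i lies in the ideal, so the ordered monomials are cocycles modulo it. *)
Lemma diff_ordsum n a : seqI n (diff (osum n a)).
Proof.
elim: n a => [|n IH] a; first by rewrite /= linearZ /= diff1 scaler0.
change (seqI n.+1
  (diff (osum n (a \o cons false) + C n * osum n (a \o cons true)))).
rewrite diffD diff_C.
apply: idealD; first exact: seqIS (IH _).
apply: idealB; first by apply: seqI_P.
exact: idealMl (seqIS (IH _)).
Qed.

Variable r : nat.
Hypothesis W_triv : trivial_cohomology W.
Hypothesis P_reg : forall n u, (n < r)%N -> seqI n (P n * u) -> seqI n u.

(* With d w = P n * u modulo the ideal of n, regularity makes u closed there,
   and w - C n * u is closed up to the correction of u by a coboundary. *)
Lemma ordsum_span n w : (n <= r)%N ->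
  seqI n (diff w) -> exists a y, seqI n (w - osum n a - diff y).
Proof.
elim: n w => [|n IH] w.
  move=> _ /= dw0.
  have [c [y dy]] := closed_scalar W_triv dw0.
  by exists (fun=> c), y; rewrite dy subrr.
move=> lt_nr /seqISP[u hu].
have Jdu : seqI n (diff u).
  apply: P_reg => //.
  have := seqI_diff hu; rewrite diffB diffK sub0r diff_P => /idealN.
  by rewrite opprK.
have [a [y h1]] := IH u (ltnW lt_nr) Jdu.
set w' := w - C n * osum n a - P n * y.
have Jdw' : seqI n (diff w').
  rewrite /w' !diffB diff_C diff_P.
  set s := osum n a in h1 *.
  have -> : diff w - (P n * s - C n * diff s) - P n * diff y =
     (diff w - P n * u) + P n * (u - s - diff y) + C n * diff s.
    rewrite !mulrBr !opprB !addrA subrK [RHS]addrAC; congr (_ - _).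
    by rewrite addrAC.
    apply: idealD; first by apply: idealD => //; apply: idealMl.
  by apply: idealMl; apply: diff_ordsum.
have [b [y' h2]] := IH w' (ltnW lt_nr) Jdw'.
(* [a] gives the coefficients of the monomials containing C_n and [b] the others. The term [P n * y]
   lies in the ideal of [n.+1], so it drops out. *)
exists (fun s => if s is c :: s' then (if c then a s' else b s') else 0), y'.
apply/seqISP; exists y; move: h2; rewrite /w' [osum n.+1 _]/=.
congr (ideal_set (seqI _) _).
rewrite !opprD !addrA [RHS]addrAC; congr (_ - _).
by rewrite [LHS]addrAC; congr (_ - _); rewrite addrAC.
Qed.

(** From s + C_n t = d y + P_n u modulo the ideal of [n], first t and then s is found to be exact
    modulo that ideal, and induction kills their coefficients. *)
Lemma ordsum_indep n a y : (n <= r)%N ->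
  seqI n (osum n a - diff y) -> forall b, size b = n -> a b = 0.
Proof.
elim: n a y => [|n IH] a y.
  move=> _ /= /subr0_eq ey b /size0nil ->.
  by apply: (coboundary_scalar W_triv); exists y.
move=> lt_nr /seqISP[u]; rewrite [osum _ _]/=.
set s := osum n (_ \o cons false); set t := osum n _ => h.
(* Differentiating [h] leaves P_n (t - d u), since d s and d t lie in the ideal; regularity then
   cancels P_n. *)
have ht : seqI n (t - diff u).
  apply: P_reg => //.
  have := seqI_diff h; rewrite !diffB diffD diffK subr0 diff_C diff_P => hh.
  have ds := diff_ordsum n (a \o cons false).
  have dt := diff_ordsum n (a \o cons true).
  have := idealB (idealD hh (idealMl (C n) dt)) ds.
  congr (ideal_set (seqI _) _); rewrite mulrBr -/s -/t.
  rewrite [X in X - _]addrAC -[_ + C n * _]addrA subrK addrAC.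
  by rewrite [diff s + _]addrC addrK.
  
have a1 := IH _ _ (ltnW lt_nr) ht.
have t0 : t = 0 by apply: ordsum0 => // x y'; rewrite /= scalerDl.
rewrite t0 sub0r in ht; rewrite t0 mulr0 addr0 in h.
(* Once t = 0, d u lies in the ideal, so P_n u is congruent to d (C_n u). *)
have hs : seqI n (s - diff (y + C n * u)).
  have := idealB h (idealMl (C n) ht).
  congr (ideal_set (seqI _) _).
  by rewrite diffD diff_C mulrN opprK !opprD opprK !addrA.
have a0 := IH _ _ (ltnW lt_nr) hs.
by case=> [//|[] b] [sb]; [apply: a1|apply: a0].
Qed.

End RegularSequence.

(** * Freeness implies regularity *)

Section FreeRegular.
Context (k : fieldType) (W : diffAlgType k) (r : nat) (p : 'I_r -> W).
Hypothesis pZ : forall i, even_center (p i).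

Local Notation ev := (poly_eval p).

(** The regular sequence is indexed by [nat]; the default 0 is central and has 0 as a transgression
    cochain. *)
Definition pnat n : W := oapp p 0 (insub n).

Lemma pnatE (i : 'I_r) : pnat i = p i.
Proof. by rewrite /pnat valK. Qed.

Lemma pnatC n w : pnat n * w = w * pnat n.
Proof.
rewrite /pnat; case: insubP => /= [i _ _|_]; last by rewrite mul0r mulr0.
exact: even_centerC.
Qed.

Lemma poly_evalX i : ev 'X_i = p i.
Proof. by rewrite /poly_eval mmapX mmap1U. Qed.

Lemma poly_eval0 : ev 0 = 0.
Proof. exact: raddf0. Qed.

Lemma poly_evalD q1 q2 : ev (q1 + q2) = ev q1 + ev q2.
Proof. exact: raddfD. Qed.

Lemma poly_eval_sum (T : Type) (s : seq T) (Q : pred T)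
    (F : T -> {mpoly k[r]}) :
  ev (\sum_(t <- s | Q t) F t) = \sum_(t <- s | Q t) ev (F t).
Proof. exact: raddf_sum. Qed.

(** The polynomials satisfying the congruence contain the constants and the variables and are closed
    under sums and products. It serves for setting some of the variables, or all of them, to 0. *)
Lemma poly_eval_congr (J : ideal W)
    (tau : {mpoly k[r]} -> {mpoly k[r]}) :
    zmod_morphism tau -> monoid_morphism tau ->
    (forall c, tau c%:MP = c%:MP) -> (forall i, J (ev 'X_i - ev (tau 'X_i))) ->
  forall q, J (ev q - ev (tau q)).
Proof.
move=> tauB [tau1 tauM] tauC tauX.
have tauD x y : tau (x + y) = tau x + tau y.
  by apply/eqP; rewrite -subr_eq -tauB addrK.
pose D q := J (ev q - ev (tau q)).
have DC c : D c%:MP by rewrite /D tauC subrr; apply: ideal0.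
have DD x y : D x -> D y -> D (x + y).
  by move=> Dx Dy; rewrite /D tauD !poly_evalD opprD addrACA; apply: idealD.
have DM x y : D x -> D y -> D (x * y).
  move=> Dx Dy; rewrite /D tauM !poly_evalM //.
  have -> : ev x * ev y - ev (tau x) * ev (tau y) =
     (ev x - ev (tau x)) * ev y + ev (tau x) * (ev y - ev (tau y)).
    by rewrite mulrBl mulrBr addrA subrK.
  by apply: idealD; [apply: Defs.idealMr|apply: idealMl].
have D1 : D 1 by rewrite -mpolyC1; apply: DC.
have D0 : D 0 by rewrite -mpolyC0; apply: DC.
move=> q; rewrite [q]mpolyE; apply: (big_ind D) => // m _.
rewrite -mul_mpolyC; apply: (DM) => //; rewrite mpolyXE_id.
apply: (big_ind D) => // i _; elim: (m i) => [|n IH]; first by rewrite expr0.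
by rewrite exprS; apply: DM => //; apply: tauX.
Qed.

(** A model of the quotient by the first [n] variables inside the polynomial ring itself, so that
    the next variable visibly remains a nonzero divisor. *)
Definition trunc n : {mpoly k[r]} -> {mpoly k[r]} :=
  comp_mpoly [tuple if (i < n)%N then 0 else 'X_i | i < r].

Lemma trunc_X n i : trunc n 'X_i = if (i < n)%N then 0 else 'X_i.
Proof. by rewrite /trunc comp_mpolyXU -tnth_nth tnth_mktuple. Qed.

Lemma truncM n : {morph trunc n : x y / x * y}.
Proof. exact: rmorphM. Qed.

Lemma trunc0 n : trunc n 0 = 0.
Proof. exact: raddf0. Qed.

Lemma truncD n : {morph trunc n : x y / x + y}.
Proof. exact: raddfD. Qed.

Local Notation J := (seqI pnatC).

Lemma seqI_trunc n q : J n (ev q - ev (trunc n q)).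
Proof.
apply: poly_eval_congr => [||c|i]; first exact: raddfB.
- by split; [exact: rmorph1|exact: rmorphM].
- exact: comp_mpolyC.
rewrite trunc_X; case: ifP => lt_in; last by rewrite subrr; apply: ideal0.
by rewrite poly_eval0 subr0 poly_evalX -pnatE -[pnat i]mulr1; apply: seqI_P.
Qed.

Hypothesis SP_poly : SP_polynomial p.
Hypothesis SP_free : free_module (SP p).

(** In a basis of W over SP, multiplication by p_n acts on each coordinate, and membership in the
    ideal means that [trunc n] kills the coordinates. Regularity thus reduces to the polynomial ring
    being a domain. *)
Lemma SP_regular n u : (n < r)%N -> J n (pnat n * u) -> J n u.
Proof.
move=> lt_nr; have [inj SPE] := SP_poly; have [I [e [span indep]]] := SP_free.
have SPev q : SP p (ev q) by rewrite -SPE; exists q.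
(* Elements are written as formal sums, with no condition on their indices, so
   that sums are concatenations; coord collects the coefficients of e i. *)
pose comb (l : seq (I * {mpoly k[r]})) := \sum_(x <- l) ev x.2 * e x.1.
pose coord (l : seq (I * {mpoly k[r]})) i := \sum_(x <- l | x.1 == i) x.2.
have combE w : exists l, w = comb l.
  have [s [c [SPc ->]]] := span w.
  have {}SPc i : exists q, c i = ev q.
    by have := SPc i; rewrite -SPE => -[q _ <-]; exists q.
  exists [seq (i, projT1 (cid (SPc i))) | i <- s].
  rewrite /comb big_map; apply: eq_bigr => i _ /=.
  by case: cid => q /= <-.
have comb_coord l : comb l = \sum_(i <- undup (unzip1 l)) ev (coord l i) * e i.
  rewrite /comb (eq_big_seq (fun x =>
    \sum_(i <- undup (unzip1 l) | i == x.1) ev x.2 * e i)).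
    rewrite (exchange_big_dep predT) //=; apply: eq_bigr => i _.
    rewrite poly_eval_sum mulr_suml; apply: eq_bigl => x; exact: eq_sym.
  move=> x xl; rewrite big_mkcond /= (bigD1_seq x.1) ?undup_uniq //=;
    last first.
    by rewrite mem_undup map_f.
  by rewrite eqxx big1 ?addr0 // => i /negPf ->.
have coord0 l : comb l = 0 -> forall i, coord l i = 0.
  rewrite comb_coord => l0 i; have [il|il] := boolP (i \in undup (unzip1 l)).
    apply: inj; rewrite poly_eval0.
    exact: (indep _ (fun i => ev (coord l i)) (undup_uniq _) _ l0).
  rewrite /coord big_seq_cond big_pred0 // => x.
  apply/negP => /andP[xl /eqP xi].
  by move: il; rewrite mem_undup -xi map_f.
pose scale q (l : seq (I * {mpoly k[r]})) := [seq (x.1, q * x.2) | x <- l].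
have comb_scale q l : comb (scale q l) = ev q * comb l.
  rewrite /comb big_map mulr_sumr; apply: eq_bigr => x _ /=.
  by rewrite poly_evalM // mulrA.
have coord_scale q l i : coord (scale q l) i = q * coord l i.
  by rewrite /coord big_map mulr_sumr.
have comb_cat l l' : comb (l ++ l') = comb l + comb l' by exact: big_cat.
have coord_cat l l' i : coord (l ++ l') i = coord l i + coord l' i.
  exact: big_cat.
(* The difference of two formal sums is a concatenation with one of them scaled by -1. *)
have coord_uniq l l' : comb l = comb l' -> forall i, coord l i = coord l' i.
  move=> ll' i; have := @coord0 (l ++ scale (-1) l').
  rewrite comb_cat comb_scale ll'.
  have -> : ev (-1) = -1.
    by rewrite -sub0r poly_evalB poly_eval1 // poly_eval0 sub0r.
  rewrite mulN1r subrr => /(_ erefl i).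
  by rewrite coord_cat coord_scale mulN1r => /subr0_eq.
(* Asked for all m' >= m so that the induction hypothesis at [m] still applies at [m.+1]. *)
have J_coord m w : (m <= r)%N -> J m w -> exists2 l, w = comb l &
    forall m', (m <= m')%N -> forall i, trunc m' (coord l i) = 0.
  elim: m w => [|m IH] w.
    move=> _ /= ->; exists [::] => [|m' _ i];
      by rewrite /comb /coord big_nil ?trunc0.
  move=> lt_mr /seqISP[v /(IH _ (ltnW lt_mr))[l lE l0]].
  have [l' l'E] := combE v; pose im := Ordinal lt_mr.
  exists (l ++ scale 'X_im l') => [|m' lt_mm' i].
    rewrite comb_cat comb_scale poly_evalX -pnatE -lE l'E /= subrK //.
  rewrite coord_cat coord_scale truncD truncM trunc_X lt_mm' mul0r addr0.
  by apply: l0; apply: ltnW.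
have [l ->] := combE u; pose im := Ordinal lt_nr.
have -> : pnat n = ev 'X_im by rewrite poly_evalX -pnatE.
rewrite -comb_scale => /(J_coord _ _ (ltnW lt_nr))[l' ll' l'0].
rewrite comb_coord.
apply: big_ind => [|x y|i _]; [exact: ideal0|exact: idealD|].
apply: Defs.idealMr; have := seqI_trunc n (coord l i).
suff -> : trunc n (coord l i) = 0 by rewrite poly_eval0 subr0.
(* [trunc n] fixes X_n, so X_n times the truncated coordinate is 0. *)
have := l'0 n (leqnn n) i.
rewrite -(coord_uniq _ _ ll') coord_scale truncM trunc_X ltnn => /eqP.
rewrite mulf_eq0 => /orP[|/eqP //].
by rewrite -msupp_eq0 msuppX.
Qed.

(** Each p_i lies in the augmentation ideal; conversely, a polynomial is congruent to its constant
    term modulo the p_i. *)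
Lemma seqI_SP_ideal w : J r w <-> ideal_gen (SP_aug p) w.
Proof.
split=> [|h].
  suff JI n : (n <= r)%N -> J n w -> ideal_gen (SP_aug p) w by exact: JI.
  elim: n w => [|n IH] w.
    by move=> _ ->; apply: ideal0.
  move=> lt_nr /seqISP[u /(IH _ (ltnW lt_nr)) Iw].
  rewrite -[w](subrK (pnat n * u)); apply: idealD => //.
  apply: Defs.idealMr; apply: sub_ideal_gen; exists 'X_(Ordinal lt_nr).
    by rewrite /= mevalXU.
  by rewrite poly_evalX -pnatE.
apply: (h (J r)) => _ [q q0 <-].
rewrite -[poly_eval p q]subr0 -poly_eval0 -mpolyC0 -[X in X%:MP]q0.
apply: (@poly_eval_congr (J r) (fun q => (q.@[fun=> 0])%:MP)).
- by move=> x y; rewrite mevalB raddfB.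
- by split=> [|x y]; rewrite ?meval1 // mevalM rmorphM.
- by move=> c; rewrite mevalC.
move=> i; rewrite mevalXU mpolyC0 poly_eval0 subr0 poly_evalX.
by rewrite -pnatE -[pnat i]mulr1; apply: seqI_P.
Qed.

End FreeRegular.

(** * Clifford algebras *)

Section CliffordLift.
Import monalg.
Context (k : fieldType).

(** The kernel of F is an ideal containing X. The target is a [quot_alg], which has no [algType]
    structure, so the morphism properties are spelled out. *)
Lemma gen_quot_lift (A : algType k) (X : set A) (A' : algType k) (K : ideal A')
    (F : A -> quot_alg K) :
    linear F -> monoid_morphism F -> (forall x, X x -> F x = 0) ->
  exists phi : quot_alg (ideal_gen X) -> quot_alg K,
    [/\ linear phi, monoid_morphism phi &
        forall x, phi (quot_pi (ideal_gen X) x) = F x].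
Proof.
move=> Flin [F1 FM] FX.
have FB x y : F (x - y) = F x - F y.
  by rewrite addrC -scaleN1r Flin scaleN1r addrC.
have F0 : F 0 = 0 by rewrite -(subrr 0) FB subrr.
have FI x : ideal_gen X x -> F x = 0.
  have kerB u v : F u = 0 -> F v = 0 -> F (u - v) = 0.
    by rewrite FB => -> ->; rewrite subrr.
  have kerMl a u : F u = 0 -> F (a * u) = 0 by rewrite FM => ->; rewrite mulr0.
  have kerMr a u : F u = 0 -> F (u * a) = 0 by rewrite FM => ->; rewrite mul0r.
  by move=> /(_ (Ideal F0 kerB kerMl kerMr)); apply.
have Frepr x : F (repr (quot_pi (ideal_gen X) x)) = F x.
  by apply: subr0_eq; rewrite -FB; apply: FI; apply: quot_repr.
exists (F \o repr); split=> //=.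
- move=> a x y.
  have [{}x ->] := quot_pi_surj x; have [{}y ->] := quot_pi_surj y.
  by rewrite -quot_piZ -raddfD /= !Frepr Flin.
- split=> [|x y] /=; first by rewrite Frepr.
  have [{}x ->] := quot_pi_surj x; have [{}y ->] := quot_pi_surj y.
  by rewrite -quot_piM !Frepr FM.
Qed.

Lemma free_alg_lift (V : lmodType k) (A : algType k) (f : V -> A) :
  exists F : free_alg V -> A,
    [/\ linear F, monoid_morphism F & forall v, F (free_gen v) = f v].
Proof.
pose h (m : fmonom V) : A := \prod_(v <- fmonom_val m) f v.
have hmor : mmorphism h.
  by split=> [x y|]; rewrite /h ?fmM ?big_cat // fm1 big_nil.
pose hM : {mmorphism fmonom V -> A} :=
  HB.pack h (isMultiplicative.Build _ _ h hmor).
have comm (g : {malg k[fmonom V]}) (m m' : fmonom V) :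
    GRing.comm (in_alg A (mcoeff m g)) (hM m').
  by rewrite /GRing.comm /= mulr_algl mulr_algr.
exists (mmap (in_alg A) hM); split.
- by move=> a x y; rewrite mmapD mmapZ /= mulr_algl.
- by have [M1 M2] := commr_mmap_is_multiplicative comm; split.
- by move=> v; rewrite /free_gen mmapU /= scale1r mul1r /h fmU big_seq1.
Qed.

Lemma quot_pi_linear (A : algType k) (I : ideal A) : linear (quot_pi I).
Proof. by move=> a x y; rewrite raddfD /= quot_piZ. Qed.

Lemma quot_pi_monoid (A : algType k) (I : ideal A) :
  monoid_morphism (quot_pi I).
Proof. by split=> // x y; rewrite quot_piM. Qed.

Lemma anticomm_morph (A A' : algType k) (K : ideal A') (F : A -> quot_alg K) :
    linear F -> monoid_morphism F -> forall x y c,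
  F (x * y + y * x - c *: 1) = F x * F y + F y * F x - c *: (1 : quot_alg K).
Proof.
move=> Flin [F1 FM] x y c.
rewrite addrC -scaleNr Flin F1 scaleNr addrC; congr (_ - _).
by rewrite -[x * y]scale1r Flin scale1r !FM.
Qed.

(** The universal property, obtained by factoring the map from the free algebra first through the
    tensor algebra and then through the Clifford quotient. *)
Lemma clifford_lift (V : lmodType k) (B : {symmetric V}) (A : algType k)
    (K : ideal A) (f : V -> A) : linear f ->
    (forall u v, K (f u * f v + f v * f u - (2 * B u v) *: 1)) ->
  exists phi : clifford B -> quot_alg K,
    [/\ linear phi, monoid_morphism phi &
        forall v, phi (clifford_gen B v) = quot_pi K (f v)].
Proof.
move=> flin fB; have [F [Flin [F1 FM] Fgen]] := free_alg_lift f.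
have piB x y : quot_pi K (x - y) = quot_pi K x - quot_pi K y by exact: raddfB.
have piD x y : quot_pi K (x + y) = quot_pi K x + quot_pi K y by exact: raddfD.
have FB x y : F (x - y) = F x - F y.
  by rewrite addrC -scaleN1r Flin scaleN1r addrC.
have [||x []|T [Tlin [T1 TM] TE]] :=
  @gen_quot_lift _ (@tensor_rel k V) _ K (quot_pi K \o F).
- by move=> a x y; rewrite /= Flin piD quot_piZ.
- by split=> [|x y] /=; rewrite ?F1 ?FM ?quot_piM.
- by move=> a [u [v ->]]; rewrite /= FB Flin !Fgen flin subrr raddf0.
have Tgen v : T (tensor_gen v) = quot_pi K (f v) by rewrite TE /= Fgen.
have [|//||phi [phiL phiM phiE]] :=
  @gen_quot_lift (tensor_alg V) (clifford_rel B) _ K T.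
- exact: Tlin.
- move=> _ [u [v ->]]; rewrite (@anticomm_morph (tensor_alg V)) // !Tgen.
  suff : quot_pi K (f u * f v + f v * f u - (2 * B u v) *: 1) = quot_pi K 0.
    by rewrite piB piD !quot_piM quot_piZ raddf0.
  by apply/quot_piP; rewrite subr0.
by exists phi; split=> // v; rewrite phiE Tgen.
Qed.

(** Every element is a linear combination of words, and words grow by prepending letters. *)
Lemma free_alg_ind (V : lmodType k) (D : free_alg V -> Prop) :
    D 1 -> (forall a x y, D x -> D y -> D (a *: x + y)) ->
    (forall v x, D x -> D (free_gen v * x)) -> forall x, D x.
Proof.
move=> D1 DP Dgen.
have D0 : D 0.
  by have := DP (-1) _ _ D1 D1; rewrite scaleN1r addNr.
move=> x; rewrite [x]monalgE; apply: big_ind => //.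
  by move=> y z Dy Dz; rewrite -[y]scale1r; apply: DP.
move=> m _.
have -> : << mcoeff m x *g m >> = mcoeff m x *: << m >> + 0 :> free_alg V.
  rewrite addr0; apply/malgP=> m'; rewrite mcoeffZ !mcoeffU mulrb.
  by case: eqP; rewrite ?mulr1 ?mulr0.
apply: DP => //; case: m => s; elim: s => [|v s IH].
  suff -> : << FMonom [::] >> = 1 :> free_alg V by [].
  by rewrite -fmoneE.
have -> : << FMonom (v :: s) >> = free_gen v * << FMonom s >> :> free_alg V.
  rewrite /free_gen malgM_def fgmulUU mulr1; congr << _ >>.
  by apply/val_inj; rewrite /= fmM fmU.
exact: Dgen.
Qed.

Lemma clifford_ind (V : lmodType k) (B : {symmetric V})
    (D : clifford B -> Prop) :
    D 1 -> (forall a x y, D x -> D y -> D (a *: x + y)) ->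
    (forall v x, D x -> D (clifford_gen B v * x)) -> forall x, D x.
Proof.
move=> D1 DP Dgen x; have [{}x ->] := quot_pi_surj x.
have [{}x ->] := quot_pi_surj x.
elim/free_alg_ind: x => [|a x y Dx Dy|v x Dx] //.
- by rewrite quot_pi_linear (@quot_pi_linear (tensor_alg V)); apply: DP.
- by rewrite quot_piM (quot_piM (ideal_gen (clifford_rel B))); apply: Dgen.
Qed.

Lemma scaler_half (L : lmodType k) (x y : L) c :
  (2 : k) != 0 -> x + x = (2 * c) *: y -> x = c *: y.
Proof.
move=> two0; rewrite -mulr2n -scaler_nat -scalerA.
exact: scalerI two0 _ _.
Qed.

(** * Ordered monomials span the Clifford algebra *)

Section CliffordSpan.
Context (V : lmodType k) (B : {symmetric V}).
Local Notation gen := (clifford_gen B).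
Local Notation iota := (fun c : k => c *: (1 : clifford B)).

Lemma clifford_gen_linear : linear gen.
Proof.
move=> a u v; rewrite /clifford_gen.
have -> : tensor_gen (a *: u + v) = a *: tensor_gen u + tensor_gen v.
  rewrite /tensor_gen -quot_piZ -raddfD; apply/quot_piP; apply: sub_ideal_gen.
  by exists a, u, v.
by rewrite raddfD /= quot_piZ.
Qed.

Lemma clifford_relE u v : gen u * gen v + gen v * gen u = iota (2 * B u v).
Proof.
apply: subr0_eq; rewrite /clifford_gen -(@anticomm_morph (tensor_alg V)).
- rewrite -(raddf0 (quot_pi (ideal_gen (clifford_rel B)))); apply/quot_piP.
  by rewrite subr0; apply: sub_ideal_gen; exists u, v.
- exact: quot_pi_linear.
- exact: quot_pi_monoid.
Qed.

Lemma clifford_iotaM : {morph iota : x y / x * y}.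
Proof. by move=> x y; rewrite -[RHS]quot_scalerAl mul1r scalerA. Qed.

Lemma clifford_iotaC c (x : clifford B) : iota c * x = x * iota c.
Proof. by rewrite -[LHS]quot_scalerAl -[RHS]quot_scalerAr mul1r mulr1. Qed.

Lemma clifford_iotaE c (x : clifford B) : c *: x = iota c * x.
Proof. by rewrite -[RHS]quot_scalerAl mul1r. Qed.

(** The ordered sums contain 1 and are stable under linear combinations and left multiplication by
    generators. Since 2 is invertible, the relation with u = v makes the squares of generators
    scalar. *)
Lemma clifford_span r (e : nat -> V) : (2 : k) != 0 ->
    (forall v, exists c : 'I_r -> k, v = \sum_i c i *: e i) ->
  forall x, exists a, x = ordsum iota (gen \o e) r a.
Proof.
move=> two0 espan.
have iotaD : {morph iota : x y / x + y} by move=> x y; exact: scalerDl.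
have i1 : iota 1 = 1 by exact: scale1r.
have genD x y : gen (x + y) = gen x + gen y.
  by have := clifford_gen_linear 1 x y; rewrite !scale1r.
have gen0 : gen 0 = 0.
  by apply: (addrI (gen 0)); rewrite -genD !addr0.
have genZ c x : gen (c *: x) = c *: gen x.
  by have := clifford_gen_linear c x 0; rewrite gen0 !addr0.
have gg j : (gen \o e) j * (gen \o e) j = iota (B (e j) (e j)).
  exact: scaler_half two0 (clifford_relE (e j) (e j)).
have gC i j : (gen \o e) i * (gen \o e) j =
    iota (2 * B (e i) (e j)) - (gen \o e) j * (gen \o e) i.
  by rewrite -clifford_relE addrK.
pose S := ordsum iota (gen \o e) r.
pose D x := exists a, x = S a.
have Deq x y : x = y -> D y -> D x by move=> ->.
have D1 : D 1 := ordsum1 (gen \o e) iotaD r i1.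
have D0 : D 0.
  by exists (fun=> 0); apply: esym; apply: (ordsum0 _ iotaD).
have DD x y : D x -> D y -> D (x + y).
  move=> [a ->] [a' ->]; exists (fun b => a b + a' b).
  exact: (ordsumD (gen \o e) iotaD).
have DZ c x : D x -> D (c *: x).
  move=> [a ->]; exists (fun b => c * a b).
  apply: etrans (clifford_iotaE c (S a)) _.
  exact: (ordsumZ (gen \o e) clifford_iotaM clifford_iotaC).
have Dgen i x : (i < r)%N -> D x -> D (gen (e i) * x).
  move=> lt_ir [a ->].
  exact: (ordsum_mul iotaD clifford_iotaM clifford_iotaC a gg gC i1 lt_ir).
apply: clifford_ind => [//|c x y Dx Dy|v x Dx]; first exact: DD (DZ _ _ Dx) Dy.
have [c ->] := espan v; apply: (big_ind (fun v => D (gen v * x))).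
- by apply: Deq D0; rewrite gen0; apply: mul0r.
- by move=> u w Du Dw; apply: Deq (DD _ _ Du Dw); rewrite genD; apply: mulrDl.
move=> i _; apply: Deq (DZ (c i) _ (Dgen i _ (ltn_ord i) Dx)).
by rewrite genZ; apply: esym; apply: quot_scalerAl.
Qed.

End CliffordSpan.
End CliffordLift.

(** * The form of transgression *)

Section Transgression.
Context (k : fieldType) (W : diffAlgType k).

Definition central (x : W) := forall w, x * w = w * x.

(** Since x is even, the odd part of any primitive is again a primitive. *)
Lemma transgression_exists (x : W) :
  Defs.hom false x -> coboundary x -> exists C : W, transgression x C.
Proof.
move=> x0 [y dy]; exists (hpart true y); split; first exact: hpart_hom.
have e : diff (hpart true y) + diff (hpart false y) = x + 0.
  by rewrite addr0 -dy [in RHS](hpartE y) raddfD addrC.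
by case: (hom_uniq (diff_odd (hpart_hom true y)) (diff_odd (hpart_hom false y))
  x0 (hom0 _) e).
Qed.

Lemma diff_odd_mul (C x w : W) : transgression x C ->
  diff (C * w) = x * w - C * diff w.
Proof. by move=> [C1 dC]; rewrite (diffM w C1) dC expr1 mulN1r. Qed.

(** d(CD + DC) = xD - Cy + yC - Dx, which vanishes by centrality. *)
Lemma diff_anticomm (x y C D : W) : central x -> central y ->
  transgression x C -> transgression y D -> diff (C * D + D * C) = 0.
Proof.
move=> xc yc tC tD; rewrite raddfD /= (diff_odd_mul _ tC) (diff_odd_mul _ tD).
by rewrite tC.2 tD.2 xc (yc C) addrA subrK subrr.
Qed.

Hypothesis W_triv : trivial_cohomology W.

(** The scalar class of w is even, so comparing odd parts in w - a = d y removes it. *)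
Lemma closed_odd (w : W) : Defs.hom true w -> diff w = 0 ->
  exists2 u : W, Defs.hom false u & diff u = w.
Proof.
move=> w1 /(closed_scalar W_triv)[a [y dy]].
exists (hpart false y); first exact: hpart_hom.
have e : diff (hpart true y) + diff (hpart false y) = - (a *: 1) + w.
  by rewrite [RHS]addrC -dy [in RHS](hpartE y) raddfD addrC.
by case: (hom_uniq (diff_odd (hpart_hom true y)) (diff_odd (hpart_hom false y))
  (homN (homZ a (@hom1 k W))) w1 e).
Qed.

Lemma transgression_cob (x C C' : W) :
  transgression x C -> transgression x C' ->
  exists2 u : W, Defs.hom false u & C' = C + diff u.
Proof.
move=> [C1 dC] [C'1 dC'].
have [||u u0 du] := @closed_odd (C' - C).
- exact: homD C'1 (homN C1).
- by rewrite raddfB /= dC dC' subrr.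
by exists u; rewrite // du addrC subrK.
Qed.

(** With C' = C + d u, the difference is (d u) D + D (d u) = d(uD - Du), the terms uy and yu
    cancelling. *)
Lemma anticomm_cobl (x y C C' D : W) : central y ->
  transgression x C -> transgression x C' -> transgression y D ->
  coboundary (C' * D + D * C' - (C * D + D * C)).
Proof.
move=> yc tC tC' tD; have [u u0 ->] := transgression_cob tC tC'.
exists (u * D - D * u).
rewrite raddfB /= (diffM D u0) (diff_odd_mul _ tD) expr0 mul1r tD.2 yc.
rewrite opprB [D * _ - _]addrC addrA addrK.
by rewrite mulrDl mulrDr addrACA [X in _ = X - _]addrC addrK.
Qed.

(** The two cochains are replaced one at a time; this makes B independent of the choices. *)
Lemma anticomm_cob (x y C C' D D' : W) : central x -> central y ->
  transgression x C -> transgression x C' ->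
  transgression y D -> transgression y D' ->
  coboundary (C' * D' + D' * C' - (C * D + D * C)).
Proof.
move=> xc yc tC tC' tD tD'.
have [u du] := anticomm_cobl yc tC tC' tD'.
have [v dv] := anticomm_cobl xc tD tD' tC.
exists (u + v); rewrite raddfD /= du dv [D' * C + _]addrC [D * C + _]addrC.
by rewrite addrA subrK.
Qed.

(* The scalar a with [w]_d = a [1]_d; 0 when there is none. *)
Definition class_scalar (w : W) : k :=
  xget 0 [set a | coboundary (w - a *: 1)]%classic.

Lemma class_scalarP w : diff w = 0 -> coboundary (w - class_scalar w *: 1).
Proof.
move=> /(closed_scalar W_triv)[a ha]; rewrite /class_scalar.
by case: xgetP => // /(_ a).
Qed.

Lemma class_scalar_uniq w a : coboundary (w - a *: 1) -> class_scalar w = a.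
Proof.
move=> [u du]; rewrite /class_scalar.
case: xgetP => [b _ [v dv]|/(_ a) []]; last by exists u.
apply: subr0_eq; apply: (coboundary_scalar W_triv); exists (u - v).
by rewrite raddfB /= du dv opprB addrC subrKA scalerBl.
Qed.

Lemma class_scalar_cob w w' : diff w' = 0 -> coboundary (w - w') ->
  class_scalar w = class_scalar w'.
Proof.
move=> /class_scalarP[u du] [v dv]; apply: class_scalar_uniq; exists (u + v).
by rewrite raddfD /= du dv addrC addrA subrK.
Qed.

Lemma class_scalar_lin a w w' : diff w = 0 -> diff w' = 0 ->
  class_scalar (a *: w + w') = a * class_scalar w + class_scalar w'.
Proof.
move=> /class_scalarP[u du] /class_scalarP[v dv]; apply: class_scalar_uniq.
exists (a *: u + v); rewrite linearP /= du dv scalerBr scalerA.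
by rewrite addrACA -opprD -scalerDl.
Qed.

End Transgression.

(** * A linear choice of cochains and the form B *)

Section Assembly.
Context (k : fieldType) (k_char0 : [pchar k] =i pred0).
Context (W : diffAlgType k) (W_triv : trivial_cohomology W).
Context (r : nat) (p : 'I_r -> W) (p_free : lin_indep p).
Hypothesis pZ : forall i, even_center (p i).
Hypothesis p_cob : forall i, coboundary (p i).
Local Notation V := (lspan p).

Lemma two_neq0 : (2 : k) != 0.
Proof.
by have := k_char0 2; rewrite !inE /=; case: eqP.
Qed.

Lemma lspan_gen i : p i \in lspan_pred p.
Proof.
rewrite unfold_in; apply/asboolP; exists (fun j => (j == i)%:R).
rewrite (bigD1 i) //= eqxx scale1r big1 ?addr0 // => j /negPf ->.
exact: scale0r.
Qed.

Definition coords (x : V) : 'I_r -> k := projT1 (cid (asboolW (valP x))).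

Lemma coordsE x : val x = \sum_i coords x i *: p i.
Proof. by rewrite /coords; case: cid. Qed.

Lemma coords_uniq x c : val x = \sum_i c i *: p i -> coords x =1 c.
Proof.
rewrite coordsE => e i; apply: subr0_eq; move: i; apply: p_free.
rewrite (eq_bigr (fun i => coords x i *: p i - c i *: p i)) => [|i _].
  by rewrite sumrB e subrr.
exact: scalerBl.
Qed.

Lemma coords_linear a x y i :
  coords (a *: x + y) i = a * coords x i + coords y i.
Proof.
move: i; apply: coords_uniq.
have -> : val (a *: x + y) = a *: val x + val y by [].
rewrite !coordsE scaler_sumr -big_split.
by apply: eq_bigr => i _ /=; rewrite scalerDl scalerA.
Qed.

Definition cochain i : W :=
  projT1 (cid (transgression_exists (pZ i).2 (p_cob i))).

Lemma cochainP i : transgression (p i) (cochain i).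
Proof. by rewrite /cochain; case: cid. Qed.

(** Chosen on the basis and extended linearly, because the universal property of the Clifford
    algebra asks for a linear map. *)
Definition lin_cochain (x : V) : W := \sum_i coords x i *: cochain i.

Lemma lin_cochain_linear : linear lin_cochain.
Proof.
move=> a x y; rewrite /lin_cochain scaler_sumr -big_split.
by apply: eq_bigr => i _ /=; rewrite coords_linear scalerDl scalerA.
Qed.

Lemma lin_cochainP x : transgression (val x) (lin_cochain x).
Proof.
split; first by apply: hom_sum => i; apply: homZ; case: (cochainP i).
rewrite coordsE raddf_sum; apply: eq_bigr => i _.
by rewrite /= linearZ /= (cochainP i).2.
Qed.

Lemma lspan_central (x : V) : central (val x).
Proof.
move=> w; rewrite coordsE mulr_suml mulr_sumr; apply: eq_bigr => i _.
by rewrite -scalerAl -scalerAr (even_centerC (pZ i)).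
Qed.

Let anticomm x y :=
  lin_cochain x * lin_cochain y + lin_cochain y * lin_cochain x.

Let diff_anti x y : diff (anticomm x y) = 0.
Proof.
exact: diff_anticomm (@lspan_central x) (@lspan_central y)
  (lin_cochainP x) (lin_cochainP y).
Qed.

Definition trans_form (x y : V) : k := 2^-1 * class_scalar (anticomm x y).

Lemma trans_form_linear y : linear_for *%R (trans_form^~ y).
Proof.
move=> a x x'; rewrite /trans_form.
have -> : anticomm (a *: x + x') y = a *: anticomm x y + anticomm x' y.
  rewrite /anticomm lin_cochain_linear mulrDl mulrDr scalerDr.
  by rewrite -scalerAl -scalerAr addrACA.
by rewrite class_scalar_lin // mulrDr mulrCA.
Qed.

Lemma trans_formC x y : trans_form x y = trans_form y x.
Proof. by rewrite /trans_form /anticomm addrC. Qed.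

Lemma trans_form_bilinear :
  bilinear_for *%R (idfun \; *%R : k -> k -> k) trans_form.
Proof.
split=> [y|x a y y'] /=; first exact: trans_form_linear.
by rewrite !(trans_formC x) trans_form_linear.
Qed.

Lemma trans_form_hermitian x y :
  trans_form x y = (-1) ^+ false * idfun (trans_form y x).
Proof. by rewrite expr0 mul1r trans_formC. Qed.

Definition trans_symmetric : {symmetric V} :=
  HB.pack trans_form
    (bilinear_isBilinear.Build k V V k
      (GRing.Scale.Law.clone _ _ ( *%R ) _)
      (GRing.Scale.Law.clone _ _ (idfun \; *%R ) _)
      trans_form trans_form_bilinear)
    (isHermitianSesquilinear.Build k V false idfun
      trans_form trans_form_hermitian).

End Assembly.

(** * Cocycles and coboundaries of the quotient, lifted to W *)

Section QuotientCohomology.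
Context (k : fieldType) (W : diffAlgType k) (I : diff_ideal W).
Local Notation Q := (diff_quot I).
Local Notation pi := (quot_pi I : W -> Q).

Lemma quot_coboundary w : coboundary (pi w) <-> exists y, I (w - diff y).
Proof.
split=> [[y'] | [y Iwy]].
  have [y ->] := quot_pi_surj y' => e; exists y; apply/quot_piP; rewrite -e.
  exact: quot_diffE.
by exists (pi y); rewrite [LHS]quot_diffE; apply: esym; apply/quot_piP.
Qed.

Lemma quot_cocycle w : diff (pi w) = 0 <-> I (diff w).
Proof.
have e : diff (pi w) = pi (diff w) by exact: quot_diffE.
rewrite e -(raddf0 pi) -[X in I X]subr0; exact: quot_piP.
Qed.

End QuotientCohomology.

(** * The isomorphism with the Clifford algebra *)

Theorem theorem2p5 (k : fieldType) (k_char0 : [pchar k] =i pred0)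
    (W : diffAlgType k) (W_triv : trivial_cohomology W)
    (r : nat) (p : 'I_r -> W) (p_free : lin_indep p)
    (pZ : forall i, even_center (p i))
    (p_cob : forall i, coboundary (p i))
    (SP_poly : SP_polynomial p) (SP_free : free_module (SP p)) :
  let I := SP_ideal pZ p_cob SP_poly SP_free in
  (forall x : lspan p, exists C : W, transgression (val x) C) /\
  exists B : {symmetric (lspan p)},
    (forall (x y : lspan p) (Cx Cy : W),
       transgression (val x) Cx -> transgression (val y) Cy ->
       exists2 h : cohomology W,
         is_class (Cx * Cy + Cy * Cx) h &
         B x y *: (1 : cohomology W) = 2^-1 *: h) /\
    exists phi : clifford B -> cohomology (diff_quot I),
      [/\ linear phi, monoid_morphism phi, bijective phi &
          forall (x : lspan p) (C : W), transgression (val x) C ->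
            is_class (quot_pi I C : diff_quot I) (phi (clifford_gen B x))].
Proof.
move=> I; split.
  by move=> x; exists (lin_cochain pZ p_cob x); apply: lin_cochainP.
have two0 := two_neq0 k_char0.
pose T := lin_cochain pZ p_cob.
have Tt x : transgression (val x) (T x) := lin_cochainP pZ p_cob x.
pose B := trans_symmetric W_triv p_free pZ p_cob.
have Tlin : linear T := lin_cochain_linear p_free pZ p_cob.
have dTT x y : diff (T x * T y + T y * T x) = 0.
  exact: diff_anticomm (lspan_central pZ x) (lspan_central pZ y) (Tt x) (Tt y).
have BE x y : 2 * B x y = class_scalar (T x * T y + T y * T x).
  by rewrite /= /trans_form mulrA divff // mul1r.
exists B; split.
  move=> x y Cx Cy tx ty.
  have xc := lspan_central pZ x; have yc := lspan_central pZ y.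
  have zc : Cx * Cy + Cy * Cx \in @cocycle_pred k W.
    by rewrite unfold_in (diff_anticomm xc yc tx ty).
  exists (quot_pi (cobound_ideal W) (Cocycle zc)); first by exists (Cocycle zc).
  (* B was defined through the chosen cochains [T]; the class is the same for [Cx] and [Cy]. *)
  have -> : B x y = 2^-1 * class_scalar (Cx * Cy + Cy * Cx).
    have cob := anticomm_cob W_triv xc yc (Tt x) tx (Tt y) ty.
    by rewrite (class_scalar_cob W_triv (dTT x y) cob) -BE mulKf.
  rewrite -scalerA; congr (_ *: _); rewrite -quot_pi1 -quot_piZ.
  apply: esym; apply/quot_piP.
  by apply: class_scalarP => //; apply: diff_anticomm tx ty.
pose Q := diff_quot I; pose pi := (quot_pi I : W -> Q).
pose K := cobound_ideal Q.
have piE : ideal_set I = seqI (pnatC pZ) r.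
  by apply/funext => w; apply/propext; split=> /seqI_SP_ideal.
have I_P (x : lspan p) : I (val x).
  rewrite (coordsE x); apply: big_ind => [|u v|i _].
  - exact: ideal0.
  - exact: idealD.
  apply: idealZ; apply: sub_ideal_gen; exists 'X_i; last exact: poly_evalX.
  by rewrite /= mevalXU.
have fc x : pi (T x) \in @cocycle_pred k Q.
  by rewrite unfold_in; apply/eqP/quot_cocycle; rewrite (Tt x).2; apply: I_P.
pose f x : cocycle Q := Cocycle (fc x).
have flin : linear f.
  move=> a x y; apply/val_inj; rewrite /= Tlin; exact: quot_pi_linear.
(* The Clifford relation holds in cohomology because T x T y + T y T x - 2 B(x, y) is already a
   coboundary in W. *)
have [phi [philin [phi1 phiM] phigen]] : exists phi : clifford B -> quot_alg K,
    [/\ linear phi, monoid_morphism phi &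
        forall v, phi (clifford_gen B v) = quot_pi K (f v)].
  apply: clifford_lift => // x y.
  have -> : K (f x * f y + f y * f x - (2 * B x y) *: 1) =
      coboundary (pi (T x * T y + T y * T x - (2 * B x y) *: 1)).
    congr coboundary; rewrite raddfB raddfD.
    exact: esym (anticomm_morph (quot_pi_linear I) (quot_pi_monoid I) _ _ _).
  apply/quot_coboundary; rewrite BE.
  have [y' dy'] := class_scalarP W_triv (dTT x y).
  by exists y'; rewrite dy' subrr; apply: ideal0.
have phiD : {morph phi : x y / x + y}.
  by move=> x y; have := philin 1 x y; rewrite !scale1r.
have phiZ1 c : phi (c *: (1 : clifford B)) = c *: (1 : quot_alg K).
  have phi0 : phi 0 = 0 by apply: (addrI (phi 0)); rewrite -phiD !addr0.
  by have := philin c (1 : clifford B) 0; rewrite !addr0 phi0 phi1 addr0.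
pose e (n : nat) : lspan p := oapp (fun i => Lspan (lspan_gen p i)) 0 (insub n).
have eE n : val (e n) = pnat p n by rewrite /e /pnat; case: insubP.
pose C n := T (e n).
have C_odd n : Defs.hom true (C n) := (Tt (e n)).1.
have dC n : diff (C n) = pnat p n by rewrite -eE; exact: (Tt (e n)).2.
have P_reg n u : (n < r)%N ->
    seqI (pnatC pZ) n (pnat p n * u) -> seqI (pnatC pZ) n u.
  exact: SP_regular.
pose iota (c : k) := c *: (1 : clifford B).
pose g n := clifford_gen B (e n).
have gspan x : exists a, x = ordsum iota g r a.
  apply: (clifford_span two0) => v; exists (coords v); apply/val_inj.
  rewrite [LHS]coordsE raddf_sum; apply: eq_bigr => i _.
  by rewrite -[p i]pnatE -eE.
(* This and the next step carry an ordered sum from the Clifford algebra through cohomology classes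
   and cocycles down to W, where the results on regular sequences apply. *)
have phi_ordsum a : phi (ordsum iota g r a) =
    quot_pi K (ordsum (in_alg (cocycle Q)) (f \o e) r a).
  pose j (c : k) := c *: (1 : quot_alg K).
  rewrite (@ordsum_morph _ _ _ iota j g (fun n => quot_pi K (f (e n)))) //;
    last by move=> n; apply: phigen.
  apply: esym; apply: ordsum_morph => //.
  - exact: raddfD.
  - exact: quot_piM.
  - by move=> c; apply: quot_piZ.
have val_ordsum a : val (ordsum (in_alg (cocycle Q)) (f \o e) r a) =
    pi (ordsum (in_alg W) C r a).
  rewrite (@ordsum_morph _ _ _ _ (in_alg Q) _ (pi \o C)) //.
  apply: esym; apply: ordsum_morph => //.
  - exact: raddfD.
  - exact: quot_piM.
  - by move=> c; apply: quot_piZ.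
have phi_inj : injective phi.
  move=> x y exy; have [a ea] := gspan (x - y).
  have phi_a : phi (x - y) = 0.
    by rewrite addrC -scaleN1r philin exy scaleN1r addNr.
  have : K (ordsum (in_alg (cocycle Q)) (f \o e) r a).
    rewrite -[X in K X]subr0; apply/quot_piP.
    by rewrite -phi_ordsum -ea phi_a raddf0.
  (* An element of the kernel is an ordered sum whose image is exact, so independence kills its
     coefficients. *)
  rewrite /= /cobound_set /= val_ordsum => /quot_coboundary[w].
  rewrite piE => /(ordsum_indep C_odd dC W_triv P_reg (leqnn r)) a0.
  apply: subr0_eq; rewrite ea; apply: ordsum0 => //.
  by move=> c c'; apply: scalerDl.
have phi_surj h : exists x, phi x = h.
  have [z ->] := quot_pi_surj h; have [w ew] := quot_pi_surj (val z).
  have : I (diff w).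
    by apply/quot_cocycle; rewrite -[quot_pi I w]ew; apply: cocycleP.
  rewrite piE => /(ordsum_span C_odd dC W_triv P_reg (leqnn r))[a [y Jw]].
  exists (ordsum iota g r a); rewrite phi_ordsum; apply: esym; apply/quot_piP.
  change (coboundary (val (z - ordsum (in_alg (cocycle Q)) (f \o e) r a))).
  have -> : val (z - ordsum (in_alg (cocycle Q)) (f \o e) r a) =
      pi (w - ordsum (in_alg W) C r a).
    transitivity (val z - val (ordsum (in_alg (cocycle Q)) (f \o e) r a)) => //.
    by rewrite val_ordsum ew -raddfB.
  by apply/quot_coboundary; exists y; rewrite piE.
exists phi; split=> //.
  exists (fun h => projT1 (cid (phi_surj h))) => [x|h]; last by case: cid.
  by apply: phi_inj; case: cid.
(* Any other cochain is T x + d u, hence has the same class in the quotient. *)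
move=> x D tD; have [u u0 uE] := transgression_cob W_triv (Tt x) tD.
have zc : pi D \in @cocycle_pred k Q.
  by rewrite unfold_in; apply/eqP/quot_cocycle; rewrite tD.2; apply: I_P.
exists (Cocycle zc) => //; rewrite phigen; apply/quot_piP.
change (coboundary (val (f x - Cocycle zc))).
have -> : val (f x - Cocycle zc) = pi (T x - D) by rewrite [RHS]raddfB.
apply/quot_coboundary; exists (- u).
rewrite uE raddfN opprK opprD addrA subrr sub0r addNr.
exact: ideal0.
Qed.
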